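(* Let $f(z)=\sum_{k=0}^\infty a_kz^k$ be a formal power series with real coefficients, and for $n=0,1,2,\dots$ let $N_n=N(A(f,n);\mathbb{C}\setminus[0,\infty))$, where $A(f,n)$ is the $n$-th Appell polynomial of $f$. Then: (1) $0=N_0\le N_1\le N_2\le\cdots$; (2) if $f$ represents an entire function in $\mathcal{LP}(S_0)^*$ and $N=N(f;\mathbb{C}\setminus[0,\infty))$, then $N_n\le N$ for all $n$, and $N_n=N$ for all sufficiently large $n$; and (3) if $\langle N_n\rangle$ is bounded, then $f$ represents an entire function in $\mathcal{LP}(S_0)^*$.
   Context: For a formal power series $f(z)=\sum_{k\ge 0}a_kz^k$ and $n=0,1,2,\dots$, the $n$-th Appell polynomial of $f$ is $$A(f,n)(z)=\sum_{k=0}^n\frac{n!}{(n-k)!}a_kz^{n-k}.$$ For an entire function $g$ not identically $0$ and $X\subset\mathbb{C}$, $N(g;X)$ denotes the number of zeros of $g$ lying in $X$, counted with multiplicity; if $g$ is identically $0$, set $N(g;X)=0$. An entire function (in particular a polynomial) $g$ is real if $g(\mathbb{R})\subset\mathbb{R}$. A formal power series represents an entire function if its radius of convergence is $\infty$; it is then identified with that entire function. $S_0=[0,\infty)$. $\mathcal{LP}(S_0)$ is the class of real entire functions $g$ of the form $$g(z)=cz^me^{-\alpha z}\prod_j\left(1-\frac{z}{a_j}\right)\qquad(z\in\mathbb{C}),$$ where $c\in\mathbb{R}$, $m$ is a nonnegative integer, $\alpha\ge 0$, $a_1,a_2,\dots>0$ (a finite, possibly empty, or infinite sequence), and $\sum_ja_j^{-1}<\infty$.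 $\mathcal{LP}(S_0)^*$ is the class of real entire functions of the form $Pg$, where $P$ is a real polynomial and $g\in\mathcal{LP}(S_0)$. *)

(* Defs.v *)
From HB Require Import structures.
From mathcomp Require Import all_boot all_order all_algebra.
From mathcomp Require Import complex.
From mathcomp Require Import all_classical all_reals all_analysis.

Set Implicit Arguments.
Unset Strict Implicit.
Unset Printing Implicit Defensive.

Import Order.TTheory GRing.Theory Num.Theory.
Import numFieldNormedType.Exports.

Local Open Scope classical_set_scope.
Local Open Scope complex_scope.
Local Open Scope ring_scope.

(* The complex numbers, packed as a numFieldType: the library puts the
   topology of the modulus on every such structure, but not on the bare R[i]. *)
Definition Cplx (R : realType) : numFieldType := R[i].

Definition toC (R : realType) (x : R) : Cplx R := x%:C.

Definition appell (F : fieldType) (a : nat -> F) (n : nat) : {poly F} :=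
  \sum_(k < n.+1) ((n`!)%:R / ((n - k)`!)%:R * a k) *: 'X^(n - k).

Section ComplexFunctions.
Variable R : realType.
Local Notation C := (Cplx R).
Local Notation "x %:C" := (toC x).
Implicit Types (g p : C -> C) (z : C).

(* C is its own field of scalars here, so this is complex differentiability. *)
Definition entire g := forall z, derivable g z 1.

Definition real_function g := forall x : R, g x%:C \is Num.real.

Definition pseriesC (a : nat -> C) z : C ^nat :=
  series (fun k => a k * z ^+ k).

Definition infinite_radius (a : nat -> C) := forall z, cvgn (pseriesC a z).

Definition psum (a : nat -> C) z : C := limn (pseriesC a z).

Definition cexp : C -> C := psum (fun k => (k`!)%:R^-1).

(* When all derivatives of g vanish at z the order is infinite; it is set to 0,
   so that, g being entire, N(g; X) = 0 if g is identically 0. *)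
Definition zero_order g z : nat :=
  if pselect (exists k, derive1n k g z != 0) is left ex then ex_minn ex else 0%N.

(* N(g; X), with values in \bar R since it may be infinite. *)
Definition nb_zeros g (X : set C) : \bar R :=
  \esum_(z in X) ((zero_order g z)%:R)%:E.

(* In the order of C, 0 <= z means that z is real and nonnegative. *)
Definition offS0 : set C := ~` [set z | 0 <= z].

Definition LP_product p :=
  (exists2 s : seq R, (forall x, x \in s -> 0 < x) &
     forall z, p z = \prod_(x <- s) (1 - z / x%:C))
  \/
  (exists b : nat -> R,
     [/\ forall j, 0 < b j,
         cvgn (series (fun j => (b j)^-1)) &
         forall z, \prod_(j < n) (1 - z / (b j)%:C) @[n --> \oo] --> p z]).

Definition LP_S0 g := [/\ entire g, real_function g &
  exists (c : R) (m : nat) (alpha : R) p,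
    [/\ 0 <= alpha, LP_product p &
        forall z, g z = c%:C * z ^+ m * cexp (- alpha%:C * z) * p z]].

Definition LP_S0_star f := [/\ entire f, real_function f &
  exists (P : {poly C}) g,
    [/\ real_function (horner P), LP_S0 g & forall z, f z = P.[z] * g z]].

End ComplexFunctions.

(* Main.v *)
(* In terms of Appell polynomials, multiplying f by X - x acts as D - x and
   multiplying it by 1 - x X acts as 1 - x D.  For x >= 0 neither operation creates
   zeros off [0, oo), by Rolle's theorem applied to exp (- x z) p; together with
   A(f, n+1)' = (n+1) A(f, n) this gives the monotonicity and the upper bound.
   Conversely, n! / (n - k)! / n^k --> 1, so the reversed polynomials A(f, n),
   rescaled by 1 / n, tend to f coefficientwise.  If they have at most M zeros off
   [0, oo), they are products of a factor of degree at most M and of factors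
   1 - v X with v >= 0; a compactness argument shows that both groups of factors
   have limits, the second one being a Taylor series e^(- alpha z) prod (1 - y_j z).
   The number of zeros of f is then at most M, which also settles the equality
   in (2). *)

Require Import Defs.
From HB Require Import structures.
From mathcomp Require Import all_boot all_order all_algebra.
From mathcomp Require Import complex.
From mathcomp Require Import all_classical all_reals all_analysis.
From mathcomp Require Import zify ring lra.
Import Order.TTheory GRing.Theory Num.Theory.
Import numFieldNormedType.Exports.
Local Open Scope classical_set_scope.
Local Open Scope ring_scope.

Set Implicit Arguments.
Unset Strict Implicit.
Unset Printing Implicit Defensive.

(** Limits obtained by compactness are taken along an ultrafilter finer than [\oo]: every bounded
    real sequence converges along it, so roots, coefficients and power sums all get limits at once,
    with no diagonal extraction of subsequences. Zeros are never followed through the complex plane.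
    Nonnegative zeros are real, so the count off the half-line becomes a divisibility statement over
    [R], and closedness under coefficientwise limits is proved there. A degree may drop in such a
    limit, so each use has to exhibit a nonzero top coefficient; for Appell polynomials it comes
    from the first nonzero coefficient of the series. Neither Hurwitz's nor Hadamard's theorem
    enters: a lower bound for finite products, independent of the number of factors, gives
    nonvanishing of the limit, and Newton's identities recognise which function the limit is. *)

Lemma cvg_sumr (K : numFieldType) (T I : Type) (U : set_system T) (FU : Filter U)
    (r : seq I) (P : pred I) (f : I -> T -> K) (l : I -> K) :
  (forall i, P i -> f i n @[n --> U] --> l i) ->
  \sum_(i <- r | P i) f i n @[n --> U] --> \sum_(i <- r | P i) l i.
Proof.
move=> fl; elim: r => [|i r IH].
  by rewrite big_nil; under eq_fun do rewrite big_nil; exact: cvg_cst.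
rewrite big_cons; under eq_fun do rewrite big_cons.
by case: ifP => // Pi; apply: cvgD => //; exact: fl.
Qed.

Lemma size_XsubCM (R : idomainType) (p : {poly R}) (x : R) :
  p != 0 -> size (('X - x%:P) * p) = (size p).+1.
Proof. by move=> p0; rewrite size_monicM ?monicXsubC // size_XsubC. Qed.

(** Compactness of the segment gives a cluster point, and an ultrafilter converges to each of its
    cluster points because it contains every set or its complement. *)
Lemma ultra_bounded_cvg (R : realType) (U : set_system nat) (f : nat -> R) (K : R) :
  UltraFilter U -> (\forall n \near U, `|f n| <= K) -> exists l : R, f @ U --> l.
Proof.
move=> UU fK; have [l [_ cl]] : `[- K, K] `&` cluster (f @ U) !=set0.
  apply: (@segment_compact R (- K) K); near=> n.
  by rewrite /= in_itv /= -ler_norml; near: n.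
exists l => A lA; case: (in_ultra_setVsetC (f @^-1` A) UU) => // fA.
have [x []] := cl (~` A) A fA lA; by [].
Unshelve. all: by end_near.
Qed.

(** * Real polynomials and nonnegative roots *)

Section OffLe.
Variable R : realType.
Implicit Types (p q : {poly R}) (d : nat).

(* At most [d] zeros off the half-line, phrased by dividing out nonnegative
   roots; it holds of the zero polynomial, in agreement with [N(0; X) = 0]. *)
Definition off_le d p := exists s : seq R,
  [/\ {in s, forall x, 0 <= x}, \prod_(x <- s) ('X - x%:P) %| p &
      (size p <= (d + size s).+1)%N].

(** Cauchy's bound: beyond modulus 1 every lower power is at most [|x| ^+ N], so only large lower
    coefficients can balance the leading term. *)
Lemma root_bound N p x : (size p <= N.+2)%N -> p`_N.+1 != 0 -> root p x ->
  `|x| <= 1 + (\sum_(k < N.+1) `|p`_k|) / `|p`_N.+1|.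
Proof.
move=> sp pN /rootP px.
have [x1|x1] := leP `|x| 1.
  by apply: (le_trans x1); rewrite lerDl divr_ge0 // sumr_ge0.
rewrite -lerBlDl ler_pdivlMr ?normr_gt0 // (@le_trans _ _ (`|x| * `|p`_N.+1|)) //.
  by rewrite ler_wpM2r // gerBl.
have xN : 0 < `|x| ^+ N by rewrite exprn_gt0 // (lt_trans ltr01).
rewrite -(ler_pM2r xN) -mulrA [_ * _ ^+ N]mulrC mulrA -exprS -normrX -normrM.
move: px; rewrite (horner_coef_wide x sp) big_ord_recr /= => /eqP.
rewrite addrC addr_eq0 mulrC => /eqP ->; rewrite normrN mulr_suml.
apply: (le_trans (ler_norm_sum _ _ _)); apply: ler_sum => i _.
by rewrite normrM normrX ler_wpM2l // ler_eXn2l // -ltnS.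
Qed.

Lemma off_leXM d p x : 0 <= x -> off_le d p -> off_le d (('X - x%:P) * p).
Proof.
move=> x0 [s [s0 sp psz]]; exists (x :: s); split.
- by move=> y; rewrite inE => /orP[/eqP->|/s0].
- by rewrite big_cons dvdp_mul.
- have [->|p0] := eqVneq p 0; first by rewrite mulr0 size_poly0.
  by rewrite size_XsubCM //= addnS.
Qed.

Lemma lim_size (U : set_system nat) (UU : ProperFilter U) N (p_ : nat -> {poly R}) p :
  (\forall n \near U, (size (p_ n) <= N)%N) ->
  (forall k, (p_ n)`_k @[n --> U] --> p`_k) -> (size p <= N)%N.
Proof.
move=> sz cv; apply/leq_sizeP => j jN.
apply: (norm_cvg_unique (cv j)); apply: cvg_near_cst; near=> n.
by apply: nth_default; apply: leq_trans jN; near: n.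
Unshelve. all: by end_near.
Qed.

(* Roots of the [p_ n] stay bounded because the leading coefficient of the limit
   is nonzero, so one nonnegative root at a time can be passed to the limit. *)
Lemma off_le_closed (U : set_system nat) N d (p_ : nat -> {poly R}) p :
  UltraFilter U -> p`_N != 0 ->
  (\forall n \near U, (size (p_ n) <= N.+1)%N) ->
  (\forall n \near U, off_le d (p_ n)) ->
  (forall k, (p_ n)`_k @[n --> U] --> p`_k) -> off_le d p.
Proof.
move=> UU; elim: N p p_ => [|N IH] p p_ pN sz off cv.
  have szp := lim_size (@ultra_proper _ U UU) sz cv.
  by exists [::]; split; rewrite ?big_nil ?dvd1p // addn0 (leq_trans szp).
have szp := lim_size (@ultra_proper _ U UU) sz cv.
have [Nd|dN] := leqP N.+1 d.
  by exists [::]; split; rewrite ?big_nil ?dvd1p // addn0 (leq_trans szp).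
have pn0 : \forall n \near U, `|p`_N.+1| / 2 < `|(p_ n)`_N.+1|.
  apply: (cvgr_gt _ (cvg_norm (cv N.+1))).
  by rewrite ltr_pdivrMr // ltr_pMr ?normr_gt0 // ltr1n.
(* Here [d <= N], so for a [p_ n] of full size the list given by [off_le] is nonempty and its head
   can be split off; [(0, 0)] fills in the other indices. *)
have xr n : exists xr : R * {poly R},
    (size (p_ n) = N.+2 -> off_le d (p_ n) ->
     [/\ 0 <= xr.1, p_ n = ('X - xr.1%:P) * xr.2 & off_le d xr.2]).
  have [szn|/eqP ?] := eqVneq (size (p_ n)) N.+2; last by exists (0, 0).
  have [offn|?] := pselect (off_le d (p_ n)); last by exists (0, 0).
  have [s [s0]] := offn.
  case: s s0 => [|x s] s0 sp szs.
    by move: szs; rewrite szn addn0 ltnS leqNgt dN.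
  move: sp; rewrite big_cons => sp.
  have /dvdpP [r pr] : 'X - x%:P %| p_ n by apply: dvdp_trans sp; rewrite dvdp_mulr.
  have pn00 : p_ n != 0 by rewrite -size_poly_eq0 szn.
  have r0 : r != 0 by apply: contra_neq pn00 => r0; rewrite pr r0 mul0r.
  exists (x, r) => _ _ /=; split; rewrite ?s0 ?mem_head //; first by rewrite mulrC.
  exists s; split=> [y ys||]; first by rewrite s0 // inE ys orbT.
    by move: sp; rewrite pr mulrC dvdp_mul2r ?polyXsubC_eq0.
  by move: szs; rewrite pr mulrC size_XsubCM //= addnS.
have [xr_ xrP] := choice xr.
pose good n := [/\ size (p_ n) = N.+2, 0 <= (xr_ n).1,
   p_ n = ('X - (xr_ n).1%:P) * (xr_ n).2 & off_le d (xr_ n).2].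
have goodU : \forall n \near U, good n.
  near=> n; have pnn : (p_ n)`_N.+1 != 0.
    rewrite -normr_gt0; apply: le_lt_trans (_ : `|p`_N.+1| / 2 < _).
      by rewrite divr_ge0.
    by near: n.
  have szn : size (p_ n) = N.+2.
    apply/eqP; rewrite eqn_leq; apply/andP; split; first by near: n.
    by apply: contraNT pnn; rewrite -ltnNge ltnS => /leq_sizeP->.
  have offn : off_le d (p_ n) by near: n.
  by have [? ? ?] := xrP n szn offn.
(* Cauchy's bound made uniform: along [U] the leading coefficient exceeds half of its limit and the
   sum of the others stays below [S + 1]. *)
have [x cx] : exists x : R, (xr_ n).1 @[n --> U] --> x.
  pose S := \sum_(k < N.+1) `|p`_k|.
  apply: (@ultra_bounded_cvg _ _ _ (1 + (S + 1) / (`|p`_N.+1| / 2))).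
  have Sn : \forall n \near U, \sum_(k < N.+1) `|(p_ n)`_k| <= S + 1.
    have : (\sum_(k < N.+1) `|(p_ n)`_k|) @[n --> U] --> S.
      by apply: cvg_sumr => i _; exact: cvg_norm (cv i).
    by move=> cS; apply: (cvgr_le _ cS); rewrite ltrDl.
  near=> n; have [szn x0 pE offn] : good n by near: n.
  have pn1 : `|p`_N.+1| / 2 < `|(p_ n)`_N.+1| by near: n.
  have pp : 0 < `|p`_N.+1| / 2 by rewrite divr_gt0 // normr_gt0.
  apply: le_trans (@root_bound N (p_ n) _ _ _ _) _.
  - by rewrite szn.
  - by rewrite -normr_gt0 (lt_trans pp).
  - by rewrite pE rootM root_XsubC eqxx.
  rewrite lerD2l ler_pM ?invr_ge0 ?sumr_ge0 //; first by near: n.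
  by rewrite lef_pV2 ?posrE // ?(lt_trans pp) // ltW.
have x0 : 0 <= x.
  apply: (@closed_cvg _ _ U _ (fun n => (xr_ n).1) [set y | 0 <= y]) cx; first exact: closed_ge.
  by near=> n; have [] : good n by near: n.
have cr k : exists l : R, (xr_ n).2`_k @[n --> U] --> l.
  have szr : \forall n \near U, (size (xr_ n).2 <= N.+1)%N.
    near=> n; have [szn _ pE _] : good n by near: n.
    have r0 : (xr_ n).2 != 0.
      by apply/eqP => r0; move: szn; rewrite pE r0 mulr0 size_poly0.
    by move: szn; rewrite pE size_XsubCM // => -[->].
  have [kN|kN] := leqP N.+1 k.
    exists 0; apply: cvg_near_cst; near=> n.
    by apply: nth_default; apply: leq_trans kN; near: n.
  (* Synthetic division from the top: the quotient's coefficient at [i] is that of [p_ n] at [i.+1]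
     plus the root times the quotient's coefficient at [i.+1]. The induction runs downwards from
     [N.+1], where the quotient has coefficient 0. *)
  rewrite -(subKn (ltnW kN)); elim: (_ - k)%N => [|j [l IHj]].
    rewrite subn0; exists 0; apply: cvg_near_cst; near=> n.
    by apply: nth_default; near: n.
  have [jN|jN] := leqP N.+1 j.
    by exists l; move: IHj; rewrite !(eqP jN) (eqP (leqW jN)).
  exists (p`_(N.+1 - j) + x * l).
  have : (p_ n)`_(N.+1 - j) + (xr_ n).1 * (xr_ n).2`_(N.+1 - j) @[n --> U] -->
         p`_(N.+1 - j) + x * l by apply: cvgD (cv _) (cvgM cx IHj).
  apply: cvg_trans; apply: near_eq_cvg; near=> n.
  have [_ _ pE _] : good n by near: n.
  rewrite pE mulrBl coefB coefXM coefCM subn_eq0 leqNgt jN /=.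
  by rewrite subnS subrK.
have [l lP] := choice cr.
pose r := \poly_(k < N.+1) l k.
have rl k : (xr_ n).2`_k @[n --> U] --> r`_k.
  rewrite coef_poly; case: ltnP => [_|kN]; first exact: lP.
  apply: cvg_near_cst; near=> n.
  have [szn _ pE _] : good n by near: n.
  have r0 : (xr_ n).2 != 0.
    by apply/eqP => r0; move: szn; rewrite pE r0 mulr0 size_poly0.
  apply: nth_default; apply: leq_trans kN.
  by move: szn; rewrite pE size_XsubCM // => -[->].
have pE : p = ('X - x%:P) * r.
  apply/polyP => k; apply: (norm_cvg_unique (cv k)).
  have : (if k == 0%N then 0 else (xr_ n).2`_k.-1) - (xr_ n).1 * (xr_ n).2`_k
      @[n --> U] --> (('X - x%:P) * r)`_k.
    rewrite mulrBl coefB coefXM coefCM; apply: cvgB; last exact: cvgM cx (rl _).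
    by case: eqP => _; [exact: cvg_cst|exact: rl].
  apply: cvg_trans; apply: near_eq_cvg; near=> n.
  have [_ _ -> _] : good n by near: n.
  by rewrite mulrBl coefB coefXM coefCM.
rewrite pE; apply: off_leXM => //; apply: (IH r (fun n => (xr_ n).2)) => //.
- move: pN; rewrite pE mulrBl coefB coefXM coefCM /=.
  by rewrite [r`_N.+1]nth_default ?size_poly // mulr0 subr0.
- near=> n; have [szn _ pnE _] : good n by near: n.
  have r0 : (xr_ n).2 != 0.
    by apply/eqP => r0; move: szn; rewrite pnE r0 mulr0 size_poly0.
  by move: szn; rewrite pnE size_XsubCM // => -[->].
- near=> n; by have [] : good n by near: n.
Unshelve. all: by end_near.
Qed.
Lemma poly_Rolle (f : {poly R}) u v : u < v -> root f u -> root f v ->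
  exists2 c, u < c < v & root f^`() c.
Proof.
move=> uv /rootP fu /rootP fv.
have [|||c] := @Rolle R (horner f) u v uv.
- by move=> x _; exact: derivable_horner.
- apply: continuous_subspaceT => x; exact: continuous_horner.
- by rewrite fu fv.
rewrite in_itv /= => uc dc; exists c => //; apply/rootP.
have d1 := is_derive_poly f c.
by rewrite -(@derive_val _ _ _ _ _ _ _ d1) (@derive_val _ _ _ _ _ _ _ dc).
Qed.

(** The new list is strictly increasing because it interlaces the old one. The bound by the last
    root serves when an auxiliary root is appended at the end and must not be met again. *)
Lemma rolle_path (f : {poly R}) x t : path <%R x t -> all (root f) (x :: t) ->
  exists t', [/\ size t' = size t, path <%R x t', all (root f^`()) t' &
                 all (fun c => c < last x t) t'].
Proof.
elim: t x => [|y t IH] x; first by exists [::].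
move=> /= /andP[xy pt] /and3P[fx fy ft].
have [t' [st' pt' rt' lt']] := IH y pt ltac:(by rewrite /= fy).
have [c /andP[xc cy] rc] := poly_Rolle xy fx fy.
exists (c :: t'); split => /=; rewrite ?st' ?xc ?rc ?rt' //.
  by case: (t') pt' => //= z t'' /andP[yz ->]; rewrite (lt_trans cy).
rewrite lt' andbT (lt_le_trans cy) //.
have := pt; rewrite lt_path_sortedE => /andP[/allP yt _].
have := mem_last y t; rewrite inE => /orP[/eqP-> //|/yt /ltW //].
Qed.

(* [(1 - a X / K)^K p] mimics [exp(- a x) p], and its extra root [K / a], beyond
   those of [p], makes up for the root lost in Rolle's theorem. *)
Lemma off_le_tdiff_distinct d q (t : seq R) (a : R) n :
  0 <= a -> sorted <%R t -> {in t, forall y, 0 <= y} ->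
  {in t, forall y, a / n.+1%:R * y < 1} -> (size q <= d.+1)%N ->
  let p := q * \prod_(y <- t) ('X - y%:P) in
  off_le d ((1 - (a / n.+1%:R) *: 'X) * p^`() - a *: p).
Proof.
set b := a / n.+1%:R => a0 st t0 tb sq p.
have [pz|pn0] := eqVneq p 0.
  by exists [::]; split=> //; rewrite pz deriv0 mulr0 scaler0 subr0 ?dvdp0 ?size_poly0.
have szp : (size p <= (d + size t).+1)%N.
  by rewrite (leq_trans (size_polyMleq _ _)) // size_prod_XsubC addnS /= -addSn leq_add2r.
have szp' : (size p^`() < size p)%N by rewrite lt_size_deriv.
set h := _ - _.
have szh : (size h <= size p)%N.
  rewrite (leq_trans (size_polyD _ _)) // geq_max size_polyN size_scale_leq andbT.
  rewrite (leq_trans (size_polyMleq _ _)) //.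
  have : (size (1 - b *: 'X : {poly R})%R <= 2)%N.
    rewrite (leq_trans (size_polyD _ _)) // geq_max size_polyN size_poly1 /=.
    by rewrite (leq_trans (size_scale_leq _ _)) // size_polyX.
  by move: szp'; move: (size _) (size _) (size _) => k l m; lia.
case: t st t0 tb @p pn0 szp szp' @h szh => [|x t] st t0 tb p pn0 szp szp' h szh.
  by exists [::]; split; rewrite ?big_nil ?dvd1p // (leq_trans szh).
have rp : all (root p) (x :: t).
  by apply/allP => y yt; rewrite /p rootM root_prod_XsubC yt orbT.
(* For [a = 0] there is no auxiliary root, but the degree of the derivative drops by one, which
   matches the root lost in Rolle's theorem. *)
move: (a0); rewrite le_eqVlt => /orP[/eqP az|apos].
  have [t' [st' pt' rt' _]] := rolle_path st rp.
  have hE : h = p^`().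
    by rewrite /h /b -az mul0r !scale0r !subr0 mul1r.
  exists t'; split.
  - move=> y yt'; have := pt'; rewrite lt_path_sortedE => /andP[/allP /(_ y yt') xy _].
    by rewrite ltW // (le_lt_trans _ xy) // t0 ?mem_head.
  - rewrite hE; apply: uniq_roots_dvdp => //; rewrite uniq_rootsE.
    by move: pt'; rewrite lt_path_sortedE => /andP[_ /lt_sorted_uniq].
  - by rewrite hE st' -ltnS (leq_trans szp') // (leq_trans szp) //= addnS.
have bpos : 0 < b by rewrite divr_gt0.
(* As [b * n.+1 = a], the derivative of [G] is [h] times [(1 - b X) ^+ n]. The latter does not
   vanish to the left of [b^-1], so the critical points of [G] found there are roots of [h]. *)
pose G := (1 - b *: 'X) ^+ n.+1 * p.
have G' : G^`() = (1 - b *: 'X) ^+ n * h.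
  have aE : a *: p = n.+1%:R * (b%:P * p).
    by rewrite mul_polyC mulr_natl scalerMnl -mulr_natr divfK // pnatr_eq0.
  rewrite /h aE /G derivM deriv_exp derivB derivC derivZ derivX sub0r alg_polyC /=.
  rewrite -[_ *+ n.+1]mulr_natl [_ ^+ n.+1]exprS.
  move: (1 - b *: 'X : {poly R}) (n.+1%:R : {poly R}) => B C; move: (B ^+ n) => A.
  by ring.
have rb y : y < b^-1 -> 0 < 1 - b * y.
  by rewrite subr_gt0 -ltr_pdivlMl // mulr1.
have [t' [st' pt' rt' lt']] : exists t', [/\ size t' = size (rcons t b^-1),
   path <%R x t', all (root G^`()) t' & all (fun c => c < last x (rcons t b^-1)) t'].
  apply: rolle_path.
    rewrite rcons_path; apply/andP; split; first by [].
    by rewrite -[ltRHS]mul1r ltr_pdivlMr // mulrC tb // mem_last.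
  rewrite -rcons_cons all_rcons; apply/andP; split.
    have u0 : (1 - b *: 'X).[b^-1] = 0 by rewrite !hornerE divff ?gt_eqF // subrr.
    by apply/rootP; rewrite /G hornerM horner_exp u0 expr0n mul0r.
  by apply: sub_all rp => y /= ry; rewrite /G rootM ry orbT.
move: lt'; rewrite last_rcons => /allP lt'.
exists t'; split.
- move=> y yt'; have := pt'; rewrite lt_path_sortedE => /andP[/allP /(_ y yt') xy _].
  by rewrite ltW // (le_lt_trans _ xy) // t0 ?mem_head.
- apply: uniq_roots_dvdp => //.
    apply/allP => y yt'; have := allP rt' y yt'; rewrite G' rootM => /orP[|//].
    move=> /rootP; rewrite horner_exp !hornerE => /eqP.
    by rewrite expf_eq0 gt_eqF ?andbF // rb // lt'.
  rewrite uniq_rootsE.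
  by move: pt'; rewrite lt_path_sortedE => /andP[_ /lt_sorted_uniq].
- by rewrite st' size_rcons (leq_trans szh).
Qed.
Lemma cvg_coefM (U : set_system nat) (FU : Filter U) (p_ q_ : nat -> {poly R}) p q :
  (forall k, (p_ n)`_k @[n --> U] --> p`_k) ->
  (forall k, (q_ n)`_k @[n --> U] --> q`_k) ->
  forall k, (p_ n * q_ n)`_k @[n --> U] --> (p * q)`_k.
Proof.
move=> cp cq k; rewrite coefM; under eq_fun do rewrite coefM.
by apply: cvg_sumr => i _; exact: cvgM.
Qed.

Lemma cvg_coef_prod (U : set_system nat) (FU : Filter U) (I : Type) (r : seq I)
    (p_ : I -> nat -> {poly R}) (p : I -> {poly R}) :
  (forall i k, (p_ i n)`_k @[n --> U] --> (p i)`_k) ->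
  forall k, (\prod_(i <- r) p_ i n)`_k @[n --> U] --> (\prod_(i <- r) p i)`_k.
Proof.
move=> cp; elim: r => [|i r IH] k.
  by rewrite big_nil; under eq_fun do rewrite big_nil; exact: cvg_cst.
by rewrite big_cons; under eq_fun do rewrite big_cons; exact: cvg_coefM.
Qed.

Lemma cvg_coef_deriv (U : set_system nat) (FU : Filter U) (p_ : nat -> {poly R}) p :
  (forall k, (p_ n)`_k @[n --> U] --> p`_k) ->
  forall k, (p_ n)^`()`_k @[n --> U] --> p^`()`_k.
Proof.
by move=> cp k; rewrite coef_deriv; under eq_fun do rewrite coef_deriv; exact: cvgMn.
Qed.

Lemma cvg_div_n (c : R) : c / n.+1%:R @[n --> \oo] --> (0 : R).
Proof.
rewrite -(mulr0 c); apply: cvgM; first exact: cvg_cst.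
exact: (@cvg_harmonic R).
Qed.

(* Distinct roots are enforced by moving the [j]-th one by [j / n.+1]. *)
Lemma off_le_tdiff d p (a : R) : off_le d p -> 0 <= a -> off_le d (p^`() - a *: p).
Proof.
move=> [s0 [s0_ge0 sp szp]] a0.
have [->|p0] := eqVneq p 0.
  by exists [::]; split=> //; rewrite ?big_nil ?dvd1p // deriv0 scaler0 subr0 size_poly0.
set h := _ - _.
have [->|h0] := eqVneq h 0.
  by exists [::]; split=> //; rewrite ?big_nil ?dvd1p // size_poly0.
pose s := sort <=%R s0.
have s_ge0 : {in s, forall x, 0 <= x} by move=> x; rewrite mem_sort => /s0_ge0.
have ss : sorted <=%R s by exact: sort_le_sorted.
have szs : size s = size s0 by rewrite size_sort.
have pss : perm_eq s s0 by rewrite perm_sort.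
move: sp szp; rewrite -szs -(perm_big _ pss) /= => /dvdpP[q pE] szp.
clearbody s; move=> {pss szs s0 s0_ge0}.
pose y j n : R := s`_j + j%:R / n.+1%:R.
pose t n := [seq y j n | j <- iota 0 (size s)].
pose p_ n := q * \prod_(x <- t n) ('X - x%:P).
pose h_ n := (1 - (a / n.+1%:R) *: 'X) * (p_ n)^`() - a *: p_ n.
have [U [UU ooU]] := ultraFilterLemma eventually_filter.
have PU := @ultra_proper _ U UU.
have cU c : c / n.+1%:R @[n --> U] --> (0 : R).
  exact: cvg_trans (cvg_app _ ooU) (@cvg_div_n c).
have cp k : (p_ n)`_k @[n --> U] --> p`_k.
  rewrite pE; apply: cvg_coefM => [?|{}k]; first exact: cvg_cst.
  have -> : \prod_(x <- s) ('X - x%:P) = \prod_(j <- iota 0 (size s)) ('X - (s`_j)%:P).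
    by rewrite (big_nth 0) /index_iota subn0.
  under eq_fun do rewrite /t big_map.
  apply: cvg_coef_prod => j {}k; under eq_fun do rewrite coefB coefC.
  rewrite coefB coefC; apply: cvgB; first exact: cvg_cst.
  case: eqP => _; last exact: cvg_cst.
  by rewrite -[X in _ --> X]addr0; apply: cvgD; [exact: cvg_cst|exact: cU].
have ch k : (h_ n)`_k @[n --> U] --> h`_k.
  rewrite /h coefB coefZ; under eq_fun do rewrite /h_ coefB coefZ.
  apply: cvgB; last by apply: cvgM (cp _); exact: cvg_cst.
  rewrite -[p^`()]mul1r; apply: cvg_coefM; last exact: cvg_coef_deriv.
  move=> {}k; under eq_fun do rewrite coefB coefZ.
  suff : (1 : {poly R})`_k - a / n.+1%:R * ('X : {poly R})`_k @[n --> U] -->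
         (1 : {poly R})`_k - 0 * ('X : {poly R})`_k by rewrite mul0r subr0.
  apply: cvgB; first exact: cvg_cst.
  by apply: cvgM; [exact: cU|exact: cvg_cst].
have q0 : q != 0 by apply: contra_neq p0; rewrite pE => ->; rewrite mul0r.
have szq : (size q <= d.+1)%N.
  move: szp; rewrite pE size_Mmonic ?monic_prod_XsubC //.
  by rewrite size_prod_XsubC addnS /= -addSn leq_add2r.
have szt n : size (t n) = size s by rewrite size_map size_iota.
have szpn n : (size (p_ n) <= size p)%N.
  by rewrite /p_ pE !size_Mmonic ?monic_prod_XsubC // !size_prod_XsubC szt.
(* Closedness asks for a nonzero coefficient of [h] at the top index allowed by all the sizes. For
   [a > 0] it is the leading one of [- a p]; for [a = 0] differentiation lowers the degree of the
   limit and all the sizes alike. *)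
have [N hN szh] : exists2 N, h`_N != 0 & forall n, (size (h_ n) <= N.+1)%N.
  have szpn' n : (size (p_ n)^`() <= (size p).-1)%N.
    have [->|pn0] := eqVneq (p_ n) 0; first by rewrite deriv0 size_poly0.
    rewrite -ltnS prednK ?size_poly_gt0 //; apply: leq_trans (szpn n).
    exact: lt_size_deriv.
  have [az|apos] : a = 0 \/ 0 < a.
  - by move: a0; rewrite le_eqVlt => /orP[/eqP->|]; [left|right].
  - case szpE : (size p) => [|[|N]].
    + by move/eqP: szpE; rewrite size_poly_eq0 (negPf p0).
    + have := lt_size_deriv p0; rewrite szpE ltnS leqn0 size_poly_eq0 => /eqP p'0.
      by move: h0; rewrite /h az scale0r subr0 p'0 eqxx.
    + exists N.
        rewrite /h az scale0r subr0 coef_deriv mulrn_eq0 /=.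
        by rewrite -[N.+1]/(N.+2.-1) -szpE -/(lead_coef p) lead_coef_eq0.
      by move=> n; rewrite /h_ az mul0r !scale0r !subr0 mul1r (leq_trans (szpn' n)) // szpE.
  - exists (size p).-1.
      rewrite /h coefB coefZ [_^`()`_ _]nth_default; last first.
        by rewrite -ltnS prednK ?size_poly_gt0 // lt_size_deriv.
      by rewrite sub0r oppr_eq0 mulf_eq0 negb_or gt_eqF //= -/(lead_coef p) lead_coef_eq0.
    move=> n; rewrite prednK ?size_poly_gt0 // /h_ (leq_trans (size_polyD _ _)) //.
    rewrite geq_max size_polyN (leq_trans (size_scale_leq _ _)) // andbT.
    rewrite (leq_trans (size_polyMleq _ _)) //.
    have : (size (1 - (a / n.+1%:R) *: 'X : {poly R})%R <= 2)%N.
      rewrite (leq_trans (size_polyD _ _)) // geq_max size_polyN size_poly1 /=.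
      by rewrite (leq_trans (size_scale_leq _ _)) // size_polyX.
    move: (szpn' n) p0; rewrite -size_poly_eq0.
    by move: (size _) (size _) (size _) => k l m; lia.
apply: (@off_le_closed U N d h_ h UU) => //; first by near=> n.
near=> n; apply: off_le_tdiff_distinct => //.
- apply: (homo_sorted_in (P := fun j => j < size s)%N) (iota_ltn_sorted 0 (size s)).
    move=> i j; rewrite !unfold_in /= => im jm ij.
    apply: ler_ltD; last by rewrite ltr_pM2r ?invr_gt0 // ltr_nat.
    by apply: (sorted_leq_nth le_trans le_refl) => //; exact: ltnW.
  by apply/allP => j; rewrite mem_iota.
- move=> _ /mapP[j + ->]; rewrite mem_iota /= add0n => js.
  by rewrite /y addr_ge0 ?divr_ge0 // s_ge0 // mem_nth.
- move=> _ /mapP[j + ->]; rewrite mem_iota /= add0n => js.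
  (* A bound on the moved roots independent of [n], since [j / n.+1 <= j < size s]; its product with
     [a / n.+1] is eventually below 1. *)
  have yB : y j n <= \sum_(x <- s) x + (size s)%:R.
    apply: lerD.
      rewrite (big_nth 0) big_mkord (bigD1 (Ordinal js)) //= lerDl sumr_ge0 // => i _.
      by rewrite s_ge0 // mem_nth.
    rewrite ler_pdivrMr // -natrM ler_nat; apply: (leq_trans (ltnW js)).
    by rewrite leq_pmulr.
  have : a / n.+1%:R * (\sum_(x <- s) x + (size s)%:R) < 1.
    by rewrite mulrAC; near: n; apply: (cvgr_lt _ (cU _)).
  by apply: le_lt_trans; rewrite ler_wpM2l // divr_ge0.
Unshelve. all: by end_near.
Qed.
End OffLe.

(** * Modulus and limits of complex numbers *)

HB.instance Definition _ (R : realType) := GRing.RMorphism.copy (@toC R) (real_complex R : R -> Cplx R).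

Section ComplexNorm.
Variable R : realType.
Local Notation C := (Cplx R).
Implicit Types (z w : C) (x : R).

(** The norm of [Cplx R] takes its values in [Cplx R] itself; estimates with real constants need it
    in [R]. *)
Definition nrm z : R := complex.Re (`|z| : R[i]).

Lemma normC z : `|z| = toC (nrm z).
Proof. by rewrite /nrm /toC; case: z => a b; rewrite normc_def. Qed.

Lemma toC_inj : injective (@toC R).
Proof. exact: fmorph_inj. Qed.

Lemma ler_toC x y : (toC x <= toC y :> C) = (x <= y).
Proof. exact: lecR. Qed.

Lemma ltr_toC x y : (toC x < toC y :> C) = (x < y).
Proof. exact: ltcR. Qed.

Lemma toC_ge0 x : (0 <= toC x :> C) = (0 <= x).
Proof. by rewrite -ler_toC rmorph0. Qed.

Lemma nrmM z w : nrm (z * w) = nrm z * nrm w.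
Proof. by apply: toC_inj; rewrite rmorphM -!normC normrM. Qed.

Lemma nrmX z n : nrm (z ^+ n) = nrm z ^+ n.
Proof. by apply: toC_inj; rewrite rmorphXn -!normC normrX. Qed.

Lemma nrmN z : nrm (- z) = nrm z.
Proof. by apply: toC_inj; rewrite -!normC normrN. Qed.

Lemma nrm_ge0 z : 0 <= nrm z.
Proof. by rewrite -ler_toC -normC rmorph0 normr_ge0. Qed.

Lemma nrm_toC x : nrm (toC x) = `|x|.
Proof.
apply: toC_inj; rewrite -normC; have [x0|x0] := leP 0 x.
  by rewrite (ger0_norm x0); apply: ger0_norm; rewrite toC_ge0.
by rewrite (ltr0_norm x0) rmorphN -normrN; apply: ger0_norm; rewrite -rmorphN toC_ge0 oppr_ge0 ltW.
Qed.

Lemma nrm0 : nrm 0 = 0.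
Proof. by rewrite -(rmorph0 (@toC R)) nrm_toC normr0. Qed.

Lemma nrm1 : nrm 1 = 1.
Proof. by rewrite -(rmorph1 (@toC R)) nrm_toC normr1. Qed.

Lemma nrmD z w : nrm (z + w) <= nrm z + nrm w.
Proof. by rewrite -ler_toC rmorphD -!normC ler_normD. Qed.

Lemma nrm_sum (I : Type) (r : seq I) (P : pred I) (f : I -> C) :
  nrm (\sum_(i <- r | P i) f i) <= \sum_(i <- r | P i) nrm (f i).
Proof.
elim/big_rec2: _ => [|i x y _ xy]; first by rewrite nrm0.
by rewrite (le_trans (nrmD _ _)) // lerD2l.
Qed.

Lemma cvg_nrmP (T : Type) (F : set_system T) (FF : Filter F) (f : T -> C) l :
  (f @ F --> l) <-> (nrm (f x - l) @[x --> F] --> (0 : R)).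
Proof.
split=> [fl|fl].
  apply/cvgrPdist_lt => e e0; near=> x; rewrite sub0r normrN ger0_norm ?nrm_ge0 //.
  rewrite -ltr_toC -normC distrC; near: x.
  by move/cvgrPdist_lt: fl; apply; rewrite -(rmorph0 (@toC R)) ltr_toC.
apply/cvgrPdist_lt => e e0.
have eE : e = toC (nrm e) by rewrite -normC gtr0_norm.
near=> x; rewrite distrC normC.
rewrite eE ltr_toC -[ltLHS]ger0_norm ?nrm_ge0 // -normrN -[- _]sub0r; near: x.
by move/cvgrPdist_lt: fl; apply; rewrite -ltr_toC rmorph0 -eE.
Unshelve. all: by end_near.
Qed.

Lemma nrm_leRI z : nrm z <= `|complex.Re z| + `|complex.Im z|.
Proof.
have -> : nrm z = nrm (toC (complex.Re z) + ('i%C : C) * toC (complex.Im z)).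
  by rewrite /toC -complexE.
suff i1 : nrm 'i%C = 1 by rewrite (le_trans (nrmD _ _)) // nrmM !nrm_toC i1 mul1r.
apply/eqP; rewrite -(@eqrXn2 _ 2) ?nrm_ge0 // -nrmX expr1n.
by have := sqr_i R; rewrite /Cplx => ->; rewrite nrmN nrm1.
Qed.

Lemma nrm_geRe z : `|complex.Re z| <= nrm z.
Proof. by rewrite -ler_toC -normC; exact: normc_ge_Re. Qed.

Lemma nrm_geIm z : `|complex.Im z| <= nrm z.
Proof.
have -> : complex.Im z = complex.Re (- ('i%C * z)) by case: z => a b /=; rewrite !mul0r !mul1r; ring.
rewrite (le_trans (nrm_geRe _)) // nrmN nrmM.
suff -> : nrm 'i%C = 1 by rewrite mul1r.
by apply/eqP; rewrite -(@eqrXn2 _ 2) ?nrm_ge0 // -nrmX expr1n sqr_i nrmN nrm1.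
Qed.

Lemma cvg_ReIm (T : Type) (F : set_system T) (FF : Filter F) (f : T -> C) (x y : R) :
  complex.Re (f t) @[t --> F] --> x -> complex.Im (f t) @[t --> F] --> y ->
  f @ F --> ((x +i* y)%C : C).
Proof.
move=> fx fy; apply/cvg_nrmP; apply/cvgr0Pnorm_lt => e e0; near=> t.
rewrite ger0_norm ?nrm_ge0 // (le_lt_trans (nrm_leRI _)) //.
have -> : complex.Re (f t - (x +i* y)%C) = complex.Re (f t) - x by case: (f t).
have -> : complex.Im (f t - (x +i* y)%C) = complex.Im (f t) - y by case: (f t).
rewrite (splitr e); apply: ltrD; rewrite distrC; near: t.
  by move/cvgrPdist_lt: fx; apply; rewrite divr_gt0.
by move/cvgrPdist_lt: fy; apply; rewrite divr_gt0.
Unshelve. all: by end_near.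
Qed.
End ComplexNorm.

(** * Dominated convergence for series *)

Section Tannery.
Variable R : realType.
Local Notation C := (Cplx R).

Lemma cvg_series_geom_real (v : nat -> R) (K : R) :
  (forall k, `|v k| <= K / 2 ^+ k) -> cvgn (series v).
Proof.
move=> vK; apply: normed_cvg; apply: (@series_le_cvg _ _ (geometric K (2^-1))) => //=.
- by move=> n; rewrite exprVn (le_trans _ (vK n)).
- by move=> n; rewrite exprVn.
- by apply: is_cvg_geometric_series; rewrite ger0_norm ?invf_lt1 // ltr1n.
Qed.

Lemma cvg_series_geom (v : nat -> C) (K : R) :
  (forall k, nrm (v k) <= K / 2 ^+ k) -> cvgn (series v).
Proof.
move=> vK.
have reE n : complex.Re (series v n) = series (fun k => complex.Re (v k)) n.
  by rewrite /series /=; elim/big_rec2: _ => [//|k x y _ <-]; case: (v k) y => [? ?] [? ?].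
have imE n : complex.Im (series v n) = series (fun k => complex.Im (v k)) n.
  by rewrite /series /=; elim/big_rec2: _ => [//|k x y _ <-]; case: (v k) y => [? ?] [? ?].
have cre : cvgn (series (fun k => complex.Re (v k))).
  by apply: (@cvg_series_geom_real _ K) => k; exact: le_trans (nrm_geRe _) (vK k).
have cim : cvgn (series (fun k => complex.Im (v k))).
  by apply: (@cvg_series_geom_real _ K) => k; exact: le_trans (nrm_geIm _) (vK k).
apply: cvgP; apply: cvg_ReIm; [under eq_fun do rewrite reE; exact: cre|].
by under eq_fun do rewrite imE; exact: cim.
Qed.

Lemma nrm_series_tail (v : nat -> C) (K : R) J m :
  (forall k, nrm (v k) <= K / 2 ^+ k) ->
  nrm (series v (J + m)%N - series v J) <= 2 * K / 2 ^+ J - 2 * K / 2 ^+ (J + m).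
Proof.
move=> vK; elim: m => [|m IH]; first by rewrite addn0 !subrr nrm0.
rewrite addnS seriesSr [_ + v _ - _]addrAC (le_trans (nrmD _ _)) //.
rewrite (le_trans (lerD IH (vK _))) // exprS.
have h : (2 : R) ^+ (J + m) != 0 by rewrite expf_neq0.
rewrite -addrA lerD2l le_eqVlt; apply/orP; left; apply/eqP.
by field; rewrite h.
Qed.

Lemma nrm_lim_tail (v : nat -> C) (K : R) J :
  (forall k, nrm (v k) <= K / 2 ^+ k) ->
  nrm (limn (series v) - series v J) <= 2 * K / 2 ^+ J.
Proof.
move=> vK; have K0 : 0 <= K.
  by have := le_trans (nrm_ge0 _) (vK 0%N); rewrite expr0 divr1.
have cv := cvg_series_geom vK.
have /cvg_nrmP c0 : series v n @[n --> \oo] --> limn (series v) by exact: cv.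
apply/ler_addgt0Pr => e e0.
near \oo => n.
have Jn : (J <= n)%N by near: n; exact: nbhs_infty_ge.
have -> : limn (series v) - series v J =
   - (series v n - limn (series v)) + (series v n - series v J) by ring.
rewrite (le_trans (nrmD _ _)) // nrmN addrC; apply: lerD.
  rewrite -(subnKC Jn) (le_trans (nrm_series_tail _ _ vK)) //.
  by rewrite gerBl mulr_ge0 ?mulr_ge0 // invr_ge0 exprn_ge0.
apply: ltW; near: n; exact: (cvgr_lt _ c0).
Unshelve. all: by end_near.
Qed.

(** Beyond [J] both series are within [2 K / 2 ^+ J] of their partial sums, uniformly in [t], and
    finitely many terms converge. Geometric domination suffices here, since a power series of
    infinite radius can be bounded at twice the radius. *)
Lemma tannery (T : Type) (F : set_system T) (PF : ProperFilter F)
    (u : T -> nat -> C) (v : nat -> C) (K : R) :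
  (\forall t \near F, forall k, nrm (u t k) <= K / 2 ^+ k) ->
  (forall k, u t k @[t --> F] --> v k) ->
  limn (series (u t)) @[t --> F] --> limn (series v).
Proof.
move=> uK uv.
have vK k : nrm (v k) <= K / 2 ^+ k.
  have /cvg_nrmP c0 := uv k.
  apply/ler_addgt0Pr => e e0; near F => t.
  have -> : v k = u t k - (u t k - v k) by ring.
  rewrite (le_trans (nrmD _ _)) // nrmN; apply: lerD.
    have ut : forall k, nrm (u t k) <= K / 2 ^+ k by near: t; exact: uK.
    exact: ut.
  by apply: ltW; near: t; exact: (cvgr_lt _ c0).
have K0 : 0 <= K.
  by have := le_trans (nrm_ge0 _) (vK 0%N); rewrite expr0 divr1.
apply/cvg_nrmP/cvgr0Pnorm_lt => e e0.
have c0 : geometric (2 * K) (2^-1) n @[n --> \oo] --> (0 : R).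
  by apply: cvg_geometric; rewrite ger0_norm ?invf_lt1 // ltr1n.
have [J JP] : exists J, 2 * K / 2 ^+ J < e / 3.
  near \oo => J; exists J.
  by rewrite -exprVn; near: J; apply: (cvgr_lt _ c0); rewrite divr_gt0.
have sv : nrm (series (u t) J - series v J) @[t --> F] --> (0 : R).
  apply/cvg_nrmP; rewrite /series /=; apply: cvg_sumr => i _; exact: uv.
near=> t.
have ut : forall k, nrm (u t k) <= K / 2 ^+ k by near: t; exact: uK.
rewrite ger0_norm ?nrm_ge0 //.
have -> : limn (series (u t)) - limn (series v) = (limn (series (u t)) - series (u t) J) +
   ((series (u t) J - series v J) - (limn (series v) - series v J)) by ring.
have -> : e = e / 3 + (e / 3 + e / 3) by field.
rewrite (le_lt_trans (nrmD _ _)) //; apply: ltrD.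
  exact: le_lt_trans (nrm_lim_tail _ ut) JP.
rewrite (le_lt_trans (nrmD _ _)) // nrmN; apply: ltrD.
  by near: t; apply: (cvgr_lt _ sv); rewrite divr_gt0.
exact: le_lt_trans (nrm_lim_tail _ vK) JP.
Unshelve. all: by end_near.
Qed.
End Tannery.
Opaque Cplx.

(** * Complex power series and their zeros *)

Section PowerSeries.
Variable R : realType.
Local Notation C := (Cplx R).
Implicit Types (a b : nat -> C) (z w : C).

(** Equivalent to [infinite_radius], but inherited by sums, shifts and derivatives through direct
    estimates; the bound at radius [2 r] is the geometric majorant that [tannery] asks for on the
    disc of radius [r]. *)
Definition fast_decay a :=
  forall r : R, 0 <= r -> exists K : R, forall k, nrm (a k) * r ^+ k <= K.

Lemma radius_fast_decay a : infinite_radius a -> fast_decay a.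
Proof.
move=> ra r r0; have c0 := cvg_series_cvg_0 (ra (toC r)).
have /cvg_nrmP {}c0 := c0.
have [N _ NP] : \forall k \near \oo, nrm (a k) * r ^+ k <= 1.
  near=> k; rewrite -[r]ger0_norm // -normrX -[X in _ * X]nrm_toC rmorphXn -nrmM.
  by rewrite -[X in nrm X]subr0; near: k; apply: (cvgr_le _ c0).
exists (1 + \sum_(i < N) nrm (a i) * r ^+ i) => k.
have s0 : 0 <= \sum_(i < N) nrm (a i) * r ^+ i.
  by apply: sumr_ge0 => i _; rewrite mulr_ge0 ?nrm_ge0 ?exprn_ge0.
have [kN|Nk] := ltnP k N; last by rewrite (le_trans (NP _ Nk)) // lerDl.
rewrite (bigD1 (Ordinal kN)) //= addrCA lerDl addr_ge0 ?sumr_ge0 // => i _.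
by rewrite mulr_ge0 ?nrm_ge0 ?exprn_ge0.
Unshelve. all: by end_near.
Qed.

Lemma le_geom_term a (K rho : R) z : 0 <= rho -> nrm z <= rho ->
  (forall k, nrm (a k) * (2 * rho) ^+ k <= K) ->
  forall k, nrm (a k * z ^+ k) <= K / 2 ^+ k.
Proof.
move=> rho0 zr aK k; rewrite ler_pdivlMr ?exprn_gt0 // nrmM nrmX.
rewrite (le_trans _ (aK k)) // exprMn [_ ^+ k * rho ^+ k]mulrC mulrA.
by rewrite ler_wpM2r ?exprn_ge0 // ler_wpM2l ?nrm_ge0 // lerXn2r ?nnegrE ?nrm_ge0.
Qed.

Lemma fast_decay_radius a : fast_decay a -> infinite_radius a.
Proof.
move=> fa z; have [K aK] := fa (2 * nrm z) (mulr_ge0 (ler0n _ _) (nrm_ge0 z)).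
exact: cvg_series_geom (le_geom_term (nrm_ge0 z) (lexx _) aK).
Qed.

Lemma psum_tannery (T : Type) (F : set_system T) (PF : ProperFilter F)
    (A : T -> nat -> C) b z (K rho : R) : 0 <= rho -> nrm z <= rho ->
  (\forall t \near F, forall k, nrm (A t k) * (2 * rho) ^+ k <= K) ->
  (forall k, A t k @[t --> F] --> b k) ->
  psum (A t) z @[t --> F] --> psum b z.
Proof.
move=> rho0 zr AK Ab; rewrite /psum /pseriesC.
apply: (@tannery R T F PF (fun t k => A t k * z ^+ k) (fun k => b k * z ^+ k) K) => [|k].
  by near=> t; apply: (le_geom_term rho0 zr); near: t.
by apply: cvgM; [exact: Ab|exact: cvg_cst].
Unshelve. all: by end_near.
Qed.

Lemma cvg_psum a z : fast_decay a -> pseriesC a z n @[n --> \oo] --> psum a z.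
Proof. by move=> fa; exact: (fast_decay_radius fa). Qed.

Lemma cvg_psumS a z : fast_decay a -> pseriesC a z n.+1 @[n --> \oo] --> psum a z.
Proof. by move=> fa; move/(cvg_psum (z := z)): fa; rewrite -cvg_shiftS. Qed.

(* Coefficients of [(z - w) * psum b z]. *)
Definition mulX w b k : C := (if k is k'.+1 then b k' else 0) - w * b k.

Definition diff a k : C := k.+1%:R * a k.+1.

Lemma fast_decayZ c a : fast_decay a -> fast_decay (fun k => c * a k).
Proof.
move=> fa r r0; have [K aK] := fa r r0; exists (nrm c * K) => k.
by rewrite nrmM -mulrA ler_wpM2l ?nrm_ge0.
Qed.

Lemma fast_decayD a b : fast_decay a -> fast_decay b -> fast_decay (fun k => a k + b k).
Proof.
move=> fa fb r r0; have [K aK] := fa r r0; have [L bL] := fb r r0; exists (K + L) => k.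
rewrite (le_trans _ (lerD (aK k) (bL k))) // -mulrDl.
by rewrite ler_wpM2r ?exprn_ge0 // nrmD.
Qed.

Lemma fast_decay_shift a : fast_decay a -> fast_decay (fun k => if k is k'.+1 then a k' else 0).
Proof.
move=> fa r r0; have [K aK] := fa r r0; exists (r * K) => -[|k].
  by rewrite nrm0 mul0r mulr_ge0 // (le_trans _ (aK 0%N)) // mulr_ge0 ?nrm_ge0 ?exprn_ge0.
by rewrite exprS mulrCA ler_wpM2l.
Qed.

Lemma fast_decay_mulX w b : fast_decay b -> fast_decay (mulX w b).
Proof.
move=> fb; rewrite /mulX; under eq_fun do rewrite -mulNr.
by apply: fast_decayD; [exact: fast_decay_shift|exact: fast_decayZ].
Qed.

Lemma natn_le_expr2 n : n%:R <= 2 ^+ n :> R.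
Proof. by rewrite -natrX ler_nat ltnW // ltn_expl. Qed.

Lemma nrm_nat n : nrm (n%:R : C) = n%:R.
Proof. by rewrite -(rmorph_nat (@toC R)) nrm_toC normr_nat. Qed.

Lemma fast_decay_diff a : fast_decay a -> fast_decay (diff a).
Proof.
(* The powers of 2 absorb the factor [k.+1], and [r + 1], being at least 1, absorbs the shift of the
   index. *)
move=> fa r r0; have [K aK] := fa (2 * (r + 1)) (mulr_ge0 (ler0n _ _) (addr_ge0 r0 ler01)).
exists K => k; rewrite (le_trans _ (aK k.+1)) // nrmM nrm_nat mulrAC mulrC.
rewrite ler_wpM2l ?nrm_ge0 // exprMn ler_pM ?exprn_ge0 ?natn_le_expr2 //.
rewrite (@le_trans _ _ ((r + 1) ^+ k)) //.
  by rewrite lerXn2r ?nnegrE ?addr_ge0 // lerDl.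
by rewrite exprS ler_peMl ?exprn_ge0 ?addr_ge0 // lerDr.
Qed.

Lemma fast_decay_iter_diff a m : fast_decay a -> fast_decay (iter m diff a).
Proof. by move=> fa; elim: m => //= m IH; exact: fast_decay_diff. Qed.

Lemma psum_mulX w b z : fast_decay b -> psum (mulX w b) z = (z - w) * psum b z.
Proof.
move=> fb; have fm := fast_decay_mulX w fb.
have E n : pseriesC (mulX w b) z n.+1 = z * pseriesC b z n - w * pseriesC b z n.+1.
  have S0 a : pseriesC a z 0%N = 0 by rewrite /pseriesC /series /= big_geq.
  have SS a m : pseriesC a z m.+1 = pseriesC a z m + a m * z ^+ m by exact: seriesSr.
  elim: n => [|n IH]; first by rewrite !SS !S0 /mulX; ring.
  by rewrite [LHS]SS IH !(SS b n.+1) !(SS b n) /mulX exprS; ring.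
have l2 : z * pseriesC b z n - w * pseriesC b z n.+1 @[n --> \oo] -->
          z * psum b z - w * psum b z.
  apply: cvgB; apply: cvgM; [exact: cvg_cst|exact: cvg_psum|exact: cvg_cst|].
  exact: cvg_psumS.
rewrite mulrBl -(norm_cvg_lim (cvg_psumS (z := z) fm)); apply: norm_cvg_lim.
by under eq_fun do rewrite E.
Qed.

Lemma psum_at0 a : psum a 0 = a 0%N.
Proof.
rewrite /psum; apply: norm_cvg_lim; rewrite -cvg_shiftS; apply: cvg_near_cst.
near=> n; rewrite /pseriesC /series /= big_nat_recl //= expr0 mulr1 big1 ?addr0 // => i _.
by rewrite expr0n mulr0.
Unshelve. all: by end_near.
Qed.

Lemma psumZ c a z : fast_decay a -> psum (fun k => c * a k) z = c * psum a z.
Proof.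
move=> fa; rewrite [LHS]/psum; apply: norm_cvg_lim.
have -> : pseriesC (fun k => c * a k) z = (fun n => c * pseriesC a z n).
  by apply/funext => n; rewrite /pseriesC /series /= mulr_sumr; under eq_bigr do rewrite -mulrA.
by apply: cvgM; [exact: cvg_cst|exact: cvg_psum].
Qed.

Lemma psumD a b z : fast_decay a -> fast_decay b ->
  psum (fun k => a k + b k) z = psum a z + psum b z.
Proof.
move=> fa fb; rewrite [LHS]/psum; apply: norm_cvg_lim.
have -> : pseriesC (fun k => a k + b k) z = (fun n => pseriesC a z n + pseriesC b z n).
  by apply/funext => n; rewrite /pseriesC /series /= -big_split; under eq_bigr do rewrite mulrDl.
by apply: cvgD; exact: cvg_psum.
Qed.
End PowerSeries.

(** * Termwise differentiation and multiplicities *)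

Lemma cvg_exprn (K : numFieldType) (T : Type) (F : set_system T) (FF : Filter F)
    (f : T -> K) (l : K) n : f @ F --> l -> f x ^+ n @[x --> F] --> l ^+ n.
Proof.
move=> fl; elim: n => [|n IH].
  by rewrite expr0; under eq_fun do rewrite expr0; exact: cvg_cst.
by rewrite exprS; under eq_fun do rewrite exprS; exact: cvgM.
Qed.

Lemma sum_expr_split (K : nzRingType) (z : K) k :
  \sum_(i < k) z ^+ (k.-1 - i) * z ^+ i = k%:R * z ^+ k.-1.
Proof.
rewrite (eq_bigr (fun=> z ^+ k.-1)) => [|i _].
  by rewrite sumr_const card_ord mulr_natl.
by rewrite -exprD subnK //; case: k i => [[]//|k i]; rewrite -ltnS.
Qed.

Section Derivatives.
Variable R : realType.
Local Notation C := (Cplx R).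
Implicit Types (a b : nat -> C) (z w : C).

(** The quotient of [(h + z) ^+ k - z ^+ k] by [h] is expanded as a sum of products of powers, which
    has an evident limit as [h] tends to 0; dominated convergence then allows the sum over [k]. *)
Lemma cvg_psum_diff a z : fast_decay a ->
  h^-1 *: (psum a (h + z) - psum a z) @[h --> 0^'] --> psum (diff a) z.
Proof.
move=> fa; pose rho := nrm z + 1.
have rho1 : 1 <= rho by rewrite lerDr nrm_ge0.
have rho0 : 0 <= rho by rewrite (le_trans ler01).
(* For [|h| <= 1] both [z] and [h + z] lie in the disc of radius [rho]. Of the two factors 2 in the
   constant, one absorbs the [k] terms of the expanded quotient, the other gives the geometric
   majorant. *)
have [K aK] := fa (4 * rho) (mulr_ge0 (ler0n _ _) rho0).
pose T h k := a k * \sum_(i < k) (h + z) ^+ (k.-1 - i) * z ^+ i.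
have <- : limn (series (fun k => a k * (k%:R * z ^+ k.-1))) = psum (diff a) z.
  apply: norm_cvg_lim; rewrite -cvg_shiftS.
  have -> : (fun n => series (fun k => a k * (k%:R * z ^+ k.-1)) n.+1) =
            pseriesC (diff a) z.
    apply/funext => n; rewrite /pseriesC /series /= big_nat_recl //= mul0r mulr0 add0r.
    by apply: eq_bigr => i _; rewrite /diff mulrCA mulrA.
  exact: cvg_psum (fast_decay_diff fa).
suff : limn (series (T h)) @[h --> 0^'] --> limn (series (fun k => a k * (k%:R * z ^+ k.-1))).
  apply: cvg_trans; apply: near_eq_cvg; near=> h.
  have h0 : h != 0 by near: h; exact: nbhs_dnbhs_neq.
  apply: norm_cvg_lim.
  have -> : series (T h) = (fun n => h^-1 * (pseriesC a (h + z) n - pseriesC a z n)).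
    apply/funext => n; rewrite /pseriesC /series /= -sumrB mulr_sumr.
    apply: eq_bigr => k _; rewrite -mulrBr subrXX addrK mulrCA /T; congr (_ * _).
    by rewrite mulKf.
  rewrite /GRing.scale /=; apply: cvgM; first exact: cvg_cst.
  by apply: cvgB; exact: cvg_psum.
apply: (@tannery R C _ _ T _ K) => [|k].
  near=> h => k; have h1 : nrm h <= 1.
    by rewrite -ler_toC -normC rmorph1; near: h; apply: dnbhs0_le; rewrite ltr01.
  have hz : nrm (h + z) <= rho by rewrite (le_trans (nrmD _ _)) // addrC lerD2l.
  rewrite ler_pdivlMr ?exprn_gt0 // (le_trans _ (aK k)) // nrmM -mulrA.
  rewrite ler_wpM2l ?nrm_ge0 // (@le_trans _ _ (k%:R * rho ^+ k.-1 * 2 ^+ k)) //.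
    rewrite ler_wpM2r ?exprn_ge0 // -sum_expr_split (le_trans (nrm_sum _ _ _)) //.
    apply: ler_sum => i _; rewrite nrmM !nrmX ler_pM ?exprn_ge0 ?nrm_ge0 //.
      by rewrite lerXn2r ?nnegrE ?nrm_ge0.
    by rewrite lerXn2r ?nnegrE ?nrm_ge0 // lerDl.
  have -> : (4 * rho) ^+ k = 2 ^+ k * rho ^+ k * 2 ^+ k.
    by rewrite -!exprMn; congr (_ ^+ _); ring.
  rewrite ler_wpM2r ?exprn_ge0 // ler_pM ?exprn_ge0 ?natn_le_expr2 //.
  by rewrite ler_weXn2l // leq_pred.
apply: cvgM; first exact: cvg_cst.
rewrite -sum_expr_split; apply: cvg_sumr => i _; apply: cvgM; last exact: cvg_cst.
apply: cvg_exprn; rewrite -[X in _ --> X]add0r; apply: cvgD; last exact: cvg_cst.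
exact: nbhs_dnbhs.
Unshelve. all: by end_near.
Qed.

Lemma derivable_psum a z : fast_decay a -> derivable (psum a) z 1.
Proof.
move=> fa; apply/cvg_ex; exists (psum (diff a) z).
have := @cvg_psum_diff a z fa; apply: cvg_trans; apply: near_eq_cvg; near=> h.
by rewrite /= scaler1.
Unshelve. all: by end_near.
Qed.

Lemma derive1_psum a : fast_decay a -> derive1 (psum a) = psum (diff a).
Proof. by move=> fa; apply/funext => z; apply: norm_cvg_lim; exact: cvg_psum_diff. Qed.

Lemma derive1n_psum a k : fast_decay a -> derive1n k (psum a) = psum (iter k (@diff R) a).
Proof.
move=> fa; elim: k => //= k IH; rewrite /derive1n /= -/(derive1n k (psum a)) IH.
exact/derive1_psum/fast_decay_iter_diff.
Qed.

Lemma iter_diff_at0 a k : iter k (@diff R) a 0%N = k`!%:R * a k.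
Proof.
suff E j : iter k (@diff R) a j * j`!%:R = (j + k)`!%:R * a (j + k)%N.
  by have := E 0%N; rewrite fact0 mulr1.
elim: k j => [|k IH] j; first by rewrite addn0 mulrC.
by rewrite /= /diff mulrAC -natrM -factS mulrC IH addSnnS.
Qed.

Lemma psum_inj a b : fast_decay a -> fast_decay b -> psum a = psum b -> a = b.
Proof.
move=> fa fb ab; apply/funext => k; have := congr1 (fun f => derive1n k f 0) ab.
rewrite !derive1n_psum // !psum_at0 !iter_diff_at0; apply: mulfI.
by rewrite pnatr_eq0 -lt0n fact_gt0.
Qed.

(** Leibniz's rule; a linear factor has no second derivative, so two terms remain. *)
Lemma iter_diff_mulX w b m :
  iter m.+1 (@diff R) (mulX w b) =
  (fun k => mulX w (iter m.+1 (@diff R) b) k + m.+1%:R * iter m (@diff R) b k).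
Proof.
elim: m => [|m IH].
  by apply/funext => -[|k] /=; rewrite /diff /mulX; ring.
rewrite iterS IH; apply/funext => k.
rewrite !iterS; move: (iter m (@diff R) b) => c; case: k => [|k].
  by rewrite /= /diff /mulX; ring.
by rewrite /= /diff /mulX; ring.
Qed.

(** [zero_order] as a relation, with the order as an explicit witness instead of a minimum; this is
    the form in which an induction over linear factors goes through. *)
Definition order_at a z m :=
  psum (iter m (@diff R) a) z != 0 /\
  forall k, (k < m)%N -> psum (iter k (@diff R) a) z = 0.

(** At [z = w] the derivative of order [k.+1] of the product is [k.+1] times that of order [k] of
    [b]; elsewhere the first nonzero derivative is merely multiplied by [z - w]. *)
Lemma order_at_mulX w b z m : fast_decay b -> order_at b z m ->
  order_at (mulX w b) z ((z == w) + m).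
Proof.
move=> fb [nz lt0].
have E k : psum (iter k.+1 (@diff R) (mulX w b)) z =
   (z - w) * psum (iter k.+1 (@diff R) b) z + k.+1%:R * psum (iter k (@diff R) b) z.
  rewrite iter_diff_mulX psumD ?psumZ ?psum_mulX //; do ?exact: fast_decay_iter_diff.
    by apply: fast_decay_mulX; exact: fast_decay_iter_diff.
  by apply: fast_decayZ; exact: fast_decay_iter_diff.
have E0 : psum (iter 0 (@diff R) (mulX w b)) z = (z - w) * psum (iter 0 (@diff R) b) z.
  exact: psum_mulX.
case: eqP => [zw|/eqP zw] /=.
  rewrite add1n -zw in E E0 *; split; first by rewrite E subrr mul0r add0r mulf_neq0 ?pnatr_eq0.
  move=> [|k] km; first by rewrite E0 subrr mul0r.
  by rewrite E subrr mul0r add0r lt0 ?mulr0.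
rewrite add0n; split; last first.
  by move=> [|k] km; rewrite ?E0 ?E !lt0 ?mulr0 ?addr0 //; exact: ltnW.
have zw0 : z - w != 0 by rewrite subr_eq0.
case: m nz lt0 => [|m] nz lt0; first by rewrite E0 mulf_neq0.
by rewrite E (lt0 m) // mulr0 addr0 mulf_neq0.
Qed.

Lemma zero_order_psum a z m : fast_decay a -> order_at a z m -> zero_order (psum a) z = m.
Proof.
move=> fa [nz lt0]; rewrite /zero_order; case: pselect => [ex|[]]; last first.
  by exists m; rewrite derive1n_psum.
case: ex_minnP => k; rewrite derive1n_psum // => nzk kmin; apply/eqP.
rewrite eqn_leq kmin ?derive1n_psum //= leqNgt; apply/negP => /lt0 k0.
by rewrite k0 eqxx in nzk.
Qed.

Lemma fast_decay_mulXs ws b : fast_decay b -> fast_decay (foldr (@mulX R) b ws).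
Proof. by move=> fb; elim: ws => //= w ws IH; exact: fast_decay_mulX. Qed.

Lemma psum_mulXs ws b z : fast_decay b ->
  psum (foldr (@mulX R) b ws) z = \prod_(w <- ws) (z - w) * psum b z.
Proof.
move=> fb; elim: ws => [|w ws IH]; first by rewrite big_nil mul1r.
by rewrite big_cons /= psum_mulX ?IH ?mulrA //; exact: fast_decay_mulXs.
Qed.

Lemma zero_order_mulXs ws b z : fast_decay b -> psum b z != 0 ->
  zero_order (psum (foldr (@mulX R) b ws)) z = count_mem z ws.
Proof.
move=> fb bz; apply: zero_order_psum; first exact: fast_decay_mulXs.
elim: ws => [|w ws IH] /=; first by split.
by rewrite eq_sym; apply: order_at_mulX => //; exact: fast_decay_mulXs.
Qed.

(** [b] is zero-free on [X] but may carry infinitely many zeros outside, as the canonical products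
    do on the half-line. Each linear factor adds the indicator of its root to the sum of the
    orders. *)
Lemma nb_zeros_mulXs ws b (X : set C) : fast_decay b ->
  (forall z, X z -> psum b z != 0) ->
  nb_zeros (psum (foldr (@mulX R) b ws)) X = (size [seq w <- ws | w \in X])%:R%:E.
Proof.
move=> fb bX; rewrite /nb_zeros.
rewrite (eq_esum (b := fun z => ((count_mem z ws)%:R)%:E)); last first.
  by move=> z Xz; rewrite zero_order_mulXs // bX.
elim: ws => [|w ws IH]; first by rewrite esum1.
rewrite (eq_esum (b := fun z => (((w == z)%:R)%:E + ((count_mem z ws)%:R)%:E)%E)); last first.
  by move=> z _ /=; rewrite natrD EFinD.
rewrite esumD ?IH; [|by move=> *; rewrite lee_fin..].
have -> : (\esum_(z in X) ((w == z)%:R)%:E = ((w \in X)%:R : R)%:E)%E.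
  rewrite esum_mkcond (eq_esum (b := fun z => if z \in [set w] then ((w \in X)%:R)%:E else 0%E)).
    by rewrite -esum_mkcond esum_set1 // lee_fin.
  move=> z _; have [zw|zw] := eqVneq w z.
    by rewrite -zw [w \in [set _]]mem_set //; case: ifP.
  by rewrite [z \in [set _]]memNset; [case: ifP|move=> /= wz; rewrite wz eqxx in zw].
by rewrite /=; case: ifP => _ /=; rewrite -EFinD -?natrD ?add1n ?add0r.
Qed.
End Derivatives.

(** * Polynomial factors and the counting of zeros *)

Section Convolution.
Variable K : fieldType.
Implicit Types (p q : {poly K}) (b : nat -> K).

(** Cauchy product of a polynomial with a formal series: a factorisation of [f] can be stated before
    anything is known about convergence. *)
Definition conv p b k : K := \sum_(i < k.+1) p`_i * b (k - i)%N.

Lemma conv0 b : conv 0 b = (fun=> 0).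
Proof. by apply/funext => k; rewrite /conv big1 // => i _; rewrite coef0 mul0r. Qed.

Lemma conv_cons p c b :
  conv (p * 'X + c%:P) b =
  (fun k => (if k is k'.+1 then conv p b k' else 0) + c * b k).
Proof.
apply/funext => k; rewrite /conv big_ord_recl /= coefD coefMX coefC /= add0r subn0 addrC.
congr (_ + _); case: k => [|k]; first by rewrite big_ord0.
by apply: eq_bigr => i _; rewrite coefD coefMX coefC /= addr0 subSS.
Qed.

Lemma coef_conv p q : (fun k => (p * q)`_k) = conv p (fun k => q`_k).
Proof. by apply/funext => k; rewrite coefM. Qed.

End Convolution.

Section ZeroCount.
Variable R : realType.
Local Notation C := (Cplx R).

Lemma psum_conv (p : {poly C}) (b : nat -> C) : fast_decay b ->
  fast_decay (conv p b) /\ forall z, psum (conv p b) z = p.[z] * psum b z.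
Proof.
move=> fb; elim/poly_ind: p => [|p c [fp pE]].
  have f0 : fast_decay (fun=> 0 : C).
    by move=> r r0; exists 0 => k; rewrite nrm0 mul0r.
  rewrite conv0; split=> // z; rewrite horner0 mul0r.
  have -> : (fun=> 0) = (fun k : nat => 0 * (fun=> 0 : C) k) :> (nat -> C).
    by apply/funext => k; rewrite mul0r.
  by rewrite psumZ // mul0r.
have fs := fast_decay_shift fp; have fc := fast_decayZ c fb.
rewrite conv_cons; split=> [|z]; first exact: fast_decayD.
rewrite psumD // psumZ //.
have -> : (fun k => match k with 0%N => 0 | k'.+1 => conv p b k' end) = mulX 0 (conv p b).
  by apply/funext => k; rewrite /mulX mul0r subr0.
by rewrite psum_mulX // pE subr0 hornerMXaddC mulrDl mulrA [z * _]mulrC.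
Qed.

Lemma conv_toC (q : {poly R}) (B : nat -> R) :
  conv (map_poly (@toC R) q) (fun k => toC (B k)) = (fun k => toC (conv q B k)).
Proof.
apply/funext => k; rewrite /conv rmorph_sum; apply: eq_bigr => i _.
by rewrite rmorphM coef_map.
Qed.

Lemma fast_decay_poly (p : {poly C}) : fast_decay (fun k => p`_k).
Proof.
move=> r r0; exists (\sum_(i < size p) nrm p`_i * r ^+ i) => k.
have s0 (P : pred 'I_(size p)) : 0 <= \sum_(i < size p | P i) nrm p`_i * r ^+ i.
  by apply: sumr_ge0 => i _; rewrite mulr_ge0 ?nrm_ge0 ?exprn_ge0.
have [kN|Nk] := ltnP k (size p); last by rewrite nth_default // nrm0 mul0r s0.
by rewrite (bigD1 (Ordinal kN)) //= lerDl s0.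
Qed.

Lemma psum_poly (p : {poly C}) : psum (fun k => p`_k) = horner p.
Proof.
apply/funext => z; apply: norm_cvg_lim; apply: cvg_near_cst; near=> n.
rewrite /pseriesC /series /= big_mkord -horner_coef_wide //.
by near: n; exact: nbhs_infty_ge.
Unshelve. all: by end_near.
Qed.

Lemma nb_zeros_prod (c : C) (ws : seq C) (X : set C) : c != 0 ->
  nb_zeros (horner (c *: \prod_(w <- ws) ('X - w%:P))) X =
  (size [seq w <- ws | w \in X])%:R%:E.
Proof.
move=> c0; have fc := fast_decay_poly c%:P.
have cE z : psum (fun k => c%:P`_k) z = c by rewrite psum_poly hornerC.
rewrite -(nb_zeros_mulXs _ fc); last by move=> z _; rewrite cE.
congr (nb_zeros _ _); apply/funext => z; rewrite psum_mulXs // cE hornerZ horner_prod mulrC.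
by under eq_bigr do rewrite hornerXsubC.
Qed.

Lemma nb_zeros0 (X : set C) : nb_zeros (horner (0 : {poly C})) X = 0%E.
Proof.
have d0 k z : derive1n k (horner (0 : {poly C})) z = 0.
  have f0 := fast_decay_poly 0; rewrite -psum_poly derive1n_psum //.
  have -> : iter k (@diff R) (fun k : nat => (0 : {poly C})`_k) = (fun k => (0 : {poly C})`_k).
    elim: k => //= k ->; apply/funext => j; rewrite /diff !coef0 mulr0 //.
  by rewrite psum_poly horner0.
rewrite /nb_zeros esum1 // => z _; rewrite /zero_order; case: pselect => // ex.
by have [k] := ex; rewrite d0 eqxx.
Qed.

Transparent Cplx.
Lemma poly_split (p : {poly C}) : exists ws : seq C,
  p = lead_coef p *: \prod_(w <- ws) ('X - w%:P).
Proof. by have [ws pE] := @closed_field_poly_normal R[i] p; exists ws; exact: pE. Qed.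
Opaque Cplx.

Lemma offS0E (w : C) : (w \in @offS0 R) = ~~ (0 <= w).
Proof. by apply/idP/idP; [rewrite inE => /negP|move=> /negP h; rewrite inE]. Qed.

(** A nonnegative complex number is real, so the factors at nonnegative roots form a real
    polynomial, and divisibility descends from [C] to [R]. Conversely, zeros off the half-line are
    roots of the cofactor, whose degree is at most [d]. *)
Lemma off_le_nb_zeros d (p : {poly R}) :
  (nb_zeros (horner (map_poly (@toC R) p)) (@offS0 R) <= d%:R%:E)%E <-> off_le d p.
Proof.
have [->|p0] := eqVneq p 0.
  rewrite rmorph0 nb_zeros0; split=> _; last by rewrite lee_fin.
  by exists [::]; rewrite big_nil size_poly0 dvd1p.
set pc := map_poly _ p.
have pc0 : pc != 0 by rewrite map_poly_eq0.
have [ws pE] := poly_split pc.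
have szp : size p = (size ws).+1.
  by rewrite -(size_map_poly (@toC R)) -/pc pE size_scale ?lead_coef_eq0 // size_prod_XsubC.
split.
- rewrite {1}pE nb_zeros_prod ?lead_coef_eq0 // lee_fin ler_nat => wsd.
  have real_ge0 (w : C) : 0 <= w -> w = toC (complex.Re w).
    by move=> w0; rewrite -[LHS](ger0_norm w0) normC /nrm ger0_norm.
  pose ps := [seq w <- ws | 0 <= w].
  exists [seq complex.Re w | w <- ps]; split.
  + move=> _ /mapP[w + ->]; rewrite mem_filter => /andP[w0 _].
    by rewrite -toC_ge0 -real_ge0.
  + rewrite -(dvdp_map (@toC R)) -/pc pE dvdpZr ?lead_coef_eq0 //.
    rewrite rmorph_prod big_map.
    rewrite (eq_big_seq (fun w => 'X - w%:P)) => [|w]; last first.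
      rewrite mem_filter => /andP[w0 _].
      by rewrite rmorphB /= map_polyX map_polyC /= -real_ge0.
    by rewrite big_filter [X in _ %| X](bigID (fun w => 0 <= w)) /= dvdp_mulr.
  + rewrite szp size_map ltnS -(count_predC (fun w : C => 0 <= w) ws) -!size_filter addnC.
    rewrite leq_add2r; apply: leq_trans wsd; rewrite (eq_filter (a2 := fun w => w \in @offS0 R)) //.
    by move=> w; rewrite offS0E.
- move=> [s [s0 sp szs]].
  have /dvdpP[q pcE] : map_poly (@toC R) (\prod_(x <- s) ('X - x%:P)) %| pc by rewrite dvdp_map.
  have [us qE] := poly_split q.
  have q0 : q != 0 by apply: contra_neq pc0; rewrite pcE => ->; rewrite mul0r.
  have pcE' : pc = lead_coef q *: \prod_(w <- us ++ map (@toC R) s) ('X - w%:P).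
    rewrite pcE {1}qE -scalerAl big_cat /= big_map rmorph_prod /=; congr (_ *: (_ * _)).
    by apply: eq_bigr => x _; rewrite rmorphB /= map_polyX map_polyC.
  rewrite {1}pcE' nb_zeros_prod ?lead_coef_eq0 // lee_fin ler_nat filter_cat size_cat.
  have -> : [seq w <- map (@toC R) s | w \in @offS0 R] = [::].
    apply/eqP; rewrite -[_ == _]negbK -has_filter; apply/hasPn => _ /mapP[x xs ->].
    by rewrite offS0E negbK toC_ge0 s0.
  rewrite addn0 size_filter (leq_trans (count_size _ _)) //.
  move: szs; rewrite -(size_map_poly (@toC R)) -/pc pcE' size_scale ?lead_coef_eq0 //.
  by rewrite size_prod_XsubC size_cat size_map ltnS leq_add2r.
Qed.

Lemma nb_zeros_poly_nat (p : {poly C}) (X : set C) : exists d, nb_zeros (horner p) X = d%:R%:E.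
Proof.
have [->|p0] := eqVneq p 0; first by exists 0%N; rewrite nb_zeros0.
have [ws ->] := poly_split p; eexists; apply: nb_zeros_prod.
by rewrite lead_coef_eq0.
Qed.
End ZeroCount.
(** * Products of linear factors with nonnegative coefficients *)

Lemma bernoulli_ge (R : realDomainType) (t x : R) n : 0 <= t -> 0 <= x ->
  t ^+ n.+1 + n.+1%:R * x * t ^+ n <= (t + x) ^+ n.+1.
Proof.
move=> t0 x0; elim: n => [|n IH]; first by rewrite !expr1 expr0 mul1r mulr1.
rewrite [leRHS]exprS; apply: (@le_trans _ _ ((t + x) * (t ^+ n.+1 + n.+1%:R * x * t ^+ n))).
  rewrite -subr_ge0.
  have -> : (t + x) * (t ^+ n.+1 + n.+1%:R * x * t ^+ n) -
      (t ^+ n.+2 + n.+2%:R * x * t ^+ n.+1) = n.+1%:R * (x * x * t ^+ n).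
    by rewrite !exprS -[in n.+2%:R]natr1; ring.
  by rewrite !mulr_ge0 ?exprn_ge0.
by rewrite ler_wpM2l ?addr_ge0.
Qed.

Section LinearProducts.
Variable R : realType.
Local Notation C := (Cplx R).
Implicit Types (v : seq R) (x s : R) (B : nat -> R).

Definition lin_prod v : {poly R} := \prod_(x <- v) (1 - x *: 'X).

(** Exponents start at 1: along the families considered the sum of the entries is bounded, their
    number is not. *)
Definition power_sum v i := \sum_(x <- v) x ^+ i.+1.

(* Newton's identities, from which power sums determine coefficients: a limit of
   products is controlled through the limits of its power sums alone. *)
Definition newton (pi B : nat -> R) := B 0%N = 1 /\
  forall k, k.+1%:R * B k.+1 = - \sum_(i < k.+1) pi i * B (k - i)%N.

Lemma coef_lin_prod_cons x v k :
  (lin_prod (x :: v))`_k = (lin_prod v)`_k - x * (if k is k'.+1 then (lin_prod v)`_k' else 0).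
Proof.
rewrite /lin_prod big_cons mulrBl mul1r coefB -scalerAl coefZ coefXM.
by case: k => [|k].
Qed.

Lemma newton_lin_prod v : newton (power_sum v) (fun k => (lin_prod v)`_k).
Proof.
elim: v => [|x v [IH0 IH]].
  split=> [|k]; first by rewrite /lin_prod big_nil coef1.
  rewrite /lin_prod big_nil coef1 mulr0 big1 ?oppr0 // => i _.
  by rewrite /power_sum big_nil mul0r.
split=> [|k]; first by rewrite coef_lin_prod_cons IH0 mulr0 subr0.
(* In generating functions the powers of [x] sum to [x X / (1 - x X)], whose denominator cancels the
   new factor. *)
have tele : \sum_(i < k.+1) x ^+ i.+1 * (lin_prod (x :: v))`_(k - i) = x * (lin_prod v)`_k.
  elim: k => [|k IHk]; first by rewrite big_ord1 coef_lin_prod_cons /= mulr0 subr0.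
  rewrite big_ord_recl /= subn0 coef_lin_prod_cons expr1.
  under eq_bigr => i _ do rewrite /bump /= add1n subSS exprS -mulrA.
  by rewrite -mulr_sumr IHk; ring.
(* The two terms of [1 - x X] call for the induction hypothesis in degrees [k.+1] and [k]. *)
have rest : \sum_(i < k.+1) power_sum v i * (lin_prod (x :: v))`_(k - i) =
    - k.+1%:R * (lin_prod v)`_k.+1 + x * (k%:R * (lin_prod v)`_k).
  under eq_bigr => i _ do rewrite coef_lin_prod_cons mulrBr.
  rewrite sumrB mulNr IH opprK; congr (_ + _).
  case: k {tele} => [|k]; first by rewrite big_ord1 /= !mulr0 mul0r mulr0 oppr0.
  rewrite IH big_ord_recr /= subnn mulr0 mulr0 addr0 mulrN; congr (- _).
  rewrite mulr_sumr; apply: eq_bigr => i _.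
  have ik : (i <= k)%N by rewrite -ltnS.
  by rewrite subSn // mulrCA.
rewrite coef_lin_prod_cons.
under eq_bigr => i _ do rewrite /power_sum big_cons -/(power_sum v i) mulrDl.
rewrite big_split /= tele rest -natr1; ring.
Qed.

Lemma newton_unique pi B B' : newton pi B -> newton pi B' -> B = B'.
Proof.
move=> [B0 BS] [B0' BS']; apply/funext; elim/ltn_ind => -[|k] IH; first by rewrite B0 B0'.
apply: (@mulfI _ k.+1%:R); rewrite ?pnatr_eq0 // BS BS'; congr (- _).
by apply: eq_bigr => i _; rewrite IH // ltnS leq_subr.
Qed.

(** Up to sign these are elementary symmetric functions, and [k! e_k <= e_1 ^ k]; the induction step
    keeps the first two terms of a binomial expansion. The bound ignores the number of factors and
    decays fast enough for an entire limit. *)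
Lemma coef_lin_prod_bound v s k : {in v, forall x, 0 <= x} -> \sum_(x <- v) x <= s ->
  `|(lin_prod v)`_k| <= s ^+ k / k`!%:R.
Proof.
elim: v s k => [|x v IH] s k v0.
  rewrite big_nil => s0; rewrite /lin_prod big_nil coef1.
  case: k => [|k]; first by rewrite normr1 expr0 fact0 divr1.
  by rewrite normr0 divr_ge0 ?exprn_ge0.
rewrite big_cons -lerBrDl => vs.
have x0 : 0 <= x by rewrite v0 ?mem_head.
have v0' : {in v, forall y, 0 <= y} by move=> y yv; rewrite v0 // inE yv orbT.
have t0 : 0 <= s - x by rewrite (le_trans _ vs) // big_seq sumr_ge0.
rewrite coef_lin_prod_cons (le_trans (ler_normB _ _)) // normrM (ger0_norm x0).
rewrite (@le_trans _ _ ((s - x) ^+ k / k`!%:R +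
   x * (if k is k'.+1 then (s - x) ^+ k' / k'`!%:R else 0))) //.
  rewrite lerD ?IH // ler_wpM2l //; case: k => [|k]; rewrite ?normr0 //; exact: IH.
case: k => [|k]; first by rewrite mulr0 addr0.
have fk : (k`!%:R : R) != 0 by rewrite pnatr_eq0 -lt0n fact_gt0.
have -> : (s - x) ^+ k.+1 / k.+1`!%:R + x * ((s - x) ^+ k / k`!%:R) =
  ((s - x) ^+ k.+1 + k.+1%:R * x * (s - x) ^+ k) / k.+1`!%:R.
  have k1 : (k.+1%:R : R) != 0 by rewrite pnatr_eq0.
  rewrite factS natrM exprS; move: (k.+1%:R : R) k1 (k`!%:R : R) fk (_ ^+ k) => N N0 f f0 t.
  by field; rewrite f0.
rewrite ler_wpM2r ?invr_ge0 // -[s in leRHS](subrK x); exact: bernoulli_ge.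
Qed.
End LinearProducts.
Section Families.
Variable R : realType.
Local Notation C := (Cplx R).
Implicit Types (v : seq R) (x s : R) (B : nat -> R).

Lemma exp_term_bounded (s r : R) : 0 <= s -> 0 <= r ->
  exists K : R, forall k, s ^+ k / k`!%:R * r ^+ k <= K.
Proof.
move=> s0 r0; have := cvg_series_bounded (is_cvg_series_exp_coeff (s * r)).
move=> /pinfty_ex_gt0[K K0 KP]; exists K => k.
have := KP k I; rewrite /exp_coeff /= ger0_norm ?divr_ge0 ?exprn_ge0 ?mulr_ge0 //.
by rewrite exprMn mulrAC.
Qed.

Lemma fast_decay_exp_bound B s : 0 <= s -> (forall k, `|B k| <= s ^+ k / k`!%:R) ->
  fast_decay (fun k => toC (B k)).
Proof.
move=> s0 Bs r r0; have [K KP] := exp_term_bounded s0 r0; exists K => k.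
by rewrite (le_trans _ (KP k)) // nrm_toC ler_wpM2r ?exprn_ge0.
Qed.

Lemma horner_lin_prod v (z : C) :
  (map_poly (@toC R) (lin_prod v)).[z] = \prod_(x <- v) (1 - z * toC x).
Proof.
rewrite /lin_prod rmorph_prod horner_prod; apply: eq_bigr => x _.
by rewrite rmorphB rmorph1 /= map_polyZ map_polyX !hornerE mulrC.
Qed.

Lemma psum_map_poly (p : {poly R}) : psum (fun k => toC p`_k) = horner (map_poly (@toC R) p).
Proof. by rewrite -psum_poly; under [in RHS]eq_fun do rewrite coef_map. Qed.

Lemma cvg_toC (T : Type) (F : set_system T) (FF : Filter F) (f : T -> R) l :
  f @ F --> l -> toC (f t) @[t --> F] --> (toC l : C).
Proof.
move=> fl; apply/cvg_nrmP.
have -> : (fun t => nrm (toC (f t) - toC l)) = (fun t => `|f t - l|).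
  by apply/funext => t; rewrite -rmorphB nrm_toC.
rewrite -(normr0 R) -(subrr l); apply: cvg_norm; apply: cvgB => //; exact: cvg_cst.
Qed.

(** Newton's identities turn convergent power sums into convergent coefficients by strong induction,
    and the uniform bound on coefficients then gives the limit of the products at each [z]. The
    filter is arbitrary because both [\oo] and ultrafilters occur. *)
Lemma fam_cvg (T : Type) (F : set_system T) (PF : ProperFilter F) (w : T -> seq R)
    (s : R) (pi : nat -> R) : 0 <= s ->
  (\forall t \near F, {in w t, forall x, 0 <= x} /\ \sum_(x <- w t) x <= s) ->
  (forall i, power_sum (w t) i @[t --> F] --> pi i) ->
  exists B, [/\ newton pi B, forall k, (lin_prod (w t))`_k @[t --> F] --> B k,
    forall k, `|B k| <= s ^+ k / k`!%:R &
    forall z : C, \prod_(x <- w t) (1 - z * toC x) @[t --> F] --> psum (fun k => toC (B k)) z].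
Proof.
move=> s0 ws cpi.
have cE k : exists l : R, (lin_prod (w t))`_k @[t --> F] --> l.
  elim/ltn_ind: k => -[|k] IH.
    exists 1; apply: cvg_near_cst; near=> t.
    by have [-> _] := newton_lin_prod (w t).
  have /choice [l lP] : forall i : 'I_k.+1, exists l : R, (lin_prod (w t))`_(k - i) @[t --> F] --> l.
    by move=> i; apply: IH; rewrite ltnS leq_subr.
  exists (k.+1%:R^-1 * - \sum_(i < k.+1) pi i * l i).
  have -> : (fun t => (lin_prod (w t))`_k.+1) =
    (fun t => k.+1%:R^-1 * - \sum_(i < k.+1) power_sum (w t) i * (lin_prod (w t))`_(k - i)).
    apply/funext => t; have [_ <-] := newton_lin_prod (w t).
    by rewrite mulKf // pnatr_eq0.
  apply: cvgM; first exact: cvg_cst.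
  by apply: cvgN; apply: cvg_sumr => i _; apply: cvgM; [exact: cpi|exact: lP].
have [B BP] := choice cE.
have Ebound : \forall t \near F, forall k, `|(lin_prod (w t))`_k| <= s ^+ k / k`!%:R.
  by near=> t => k; apply: coef_lin_prod_bound; near: t; apply: filterS ws => t [].
have Bbound k : `|B k| <= s ^+ k / k`!%:R.
  apply: (@closed_cvg _ _ F _ (fun t => `|(lin_prod (w t))`_k|) [set y | y <= s ^+ k / k`!%:R]).
  - exact: closed_le.
  - by apply: filterS Ebound => t; apply.
  - exact: cvg_norm (BP k).
exists B; split => //.
- split=> [|k].
    apply: (norm_cvg_unique (BP 0%N)); apply: cvg_near_cst; near=> t.
    by have [-> _] := newton_lin_prod (w t).
  have c1 : k.+1%:R * (lin_prod (w t))`_k.+1 @[t --> F] --> k.+1%:R * B k.+1.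
    by apply: cvgM; [exact: cvg_cst|exact: BP].
  apply: (norm_cvg_unique c1).
  have -> : (fun t => k.+1%:R * (lin_prod (w t))`_k.+1) =
    (fun t => - \sum_(i < k.+1) power_sum (w t) i * (lin_prod (w t))`_(k - i)).
    by apply/funext => t; have [_ <-] := newton_lin_prod (w t).
  by apply: cvgN; apply: cvg_sumr => i _; apply: cvgM; [exact: cpi|exact: BP].
move=> z; have [K KP] := exp_term_bounded s0 (mulr_ge0 (ler0n R 2) (nrm_ge0 z)).
have -> : (fun t => \prod_(x <- w t) (1 - z * toC x)) =
          (fun t => psum (fun k => toC (lin_prod (w t))`_k) z).
  by apply/funext => t; rewrite psum_map_poly horner_lin_prod.
apply: (@psum_tannery _ _ F PF (fun t k => toC (lin_prod (w t))`_k) _ _ K (nrm z)) => //.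
- exact: nrm_ge0.
- apply: filterS Ebound => t Et k; rewrite (le_trans _ (KP k)) // nrm_toC.
  by rewrite ler_wpM2r ?exprn_ge0 ?mulr_ge0 ?nrm_ge0.
- by move=> k; exact: cvg_toC.
Unshelve. all: by end_near.
Qed.
End Families.
Section ExponentialFactor.
Variable R : realType.
Local Notation C := (Cplx R).
Implicit Types (v : seq R) (x s : R) (B : nat -> R).

(** Up to sign, the logarithm of [prod (1 - x z)] has the power sums divided by [i.+1] as
    coefficients; a factor [exp (- alpha z)] changes the linear one alone. *)
Definition add_head (pi : nat -> R) (alpha : R) i := if i is 0%N then pi 0%N + alpha else pi i.

(* The product over [exp_fam alpha n] is [(1 - alpha z / n.+1) ^+ n.+1]. *)
Definition exp_fam (alpha : R) n := nseq n.+1 (alpha / n.+1%:R).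

Lemma exp_fam_ge0 alpha n : 0 <= alpha ->
  {in exp_fam alpha n, forall x, 0 <= x} /\ \sum_(x <- exp_fam alpha n) x = alpha.
Proof.
move=> a0; split=> [x|].
  by rewrite mem_nseq => /andP[_ /eqP->]; rewrite divr_ge0.
by rewrite big_nseq iter_addr_0 -(mulr_natr (alpha / _)) divfK ?pnatr_eq0.
Qed.

Lemma cvg_power_sum_exp_fam alpha i :
  power_sum (exp_fam alpha n) i @[n --> \oo] --> add_head (fun=> 0) alpha i.
Proof.
have -> : (fun n => power_sum (exp_fam alpha n) i) =
          (fun n => alpha * (alpha / n.+1%:R) ^+ i).
  apply/funext => n; rewrite /power_sum big_nseq iter_addr_0 exprS -(mulr_natr (_ * _)).
  by rewrite mulrAC divfK ?pnatr_eq0.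
case: i => [|i].
  by rewrite /= add0r; under eq_fun do rewrite expr0 mulr1; exact: cvg_cst.
have -> : add_head (fun=> 0) alpha i.+1 = alpha * 0 ^+ i.+1 by rewrite expr0n mulr0.
apply: cvgM; first exact: cvg_cst.
by apply: cvg_exprn; exact: cvg_div_n.
Qed.

Lemma newton_exp (alpha : R) :
  newton (add_head (fun=> 0) alpha) (fun k => (- alpha) ^+ k / k`!%:R).
Proof.
split=> [|k]; first by rewrite expr0 fact0 divr1.
rewrite big_ord_recl /= big1 => [|i _]; last by rewrite mul0r.
have fk : (k`!%:R : R) != 0 by rewrite pnatr_eq0 -lt0n fact_gt0.
have k1 : (k.+1%:R : R) != 0 by rewrite pnatr_eq0.
rewrite subn0 add0r addr0 factS natrM exprS.
by move: (k.+1%:R : R) k1 (k`!%:R : R) fk (_ ^+ k) => N N0 f f0 t; field; rewrite f0.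
Qed.

Lemma psum_exp (alpha : R) (z : C) :
  psum (fun k => toC ((- alpha) ^+ k / k`!%:R)) z = cexp (- toC alpha * z).
Proof.
rewrite /cexp /psum /pseriesC; congr (limn (series _)); apply/funext => k.
by rewrite exprMn -rmorphN -rmorphXn mulrA -mulrA rmorphM fmorphV rmorph_nat mulrA [_ * _^-1]mulrC.
Qed.

Lemma power_sum_cat v v' i : power_sum (v ++ v') i = power_sum v i + power_sum v' i.
Proof. exact: big_cat. Qed.

(** A single family of finite products approximates the exponential and the canonical product
    together, so a statement on polynomials passes to both in one limit. Uniqueness in Newton's
    identities shows that the [exp_fam] part tends to the exponential. *)
Lemma fam_exp (w : nat -> seq R) (s alpha : R) (pi : nat -> R) (p : C -> C) :
  0 <= s -> 0 <= alpha ->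
  (forall n, {in w n, forall x, 0 <= x} /\ \sum_(x <- w n) x <= s) ->
  (forall i, power_sum (w n) i @[n --> \oo] --> pi i) ->
  (forall z : C, \prod_(x <- w n) (1 - z * toC x) @[n --> \oo] --> p z) ->
  exists B, [/\ newton (add_head pi alpha) B,
    forall k, (lin_prod (w n ++ exp_fam alpha n))`_k @[n --> \oo] --> B k,
    forall k, `|B k| <= (s + alpha) ^+ k / k`!%:R &
    forall z : C, psum (fun k => toC (B k)) z = cexp (- toC alpha * z) * p z].
Proof.
move=> s0 a0 ws cpi wp.
have [|||B [BN BE Bb Bz]] := @fam_cvg R nat \oo _ (fun n => w n ++ exp_fam alpha n)
    (s + alpha) (add_head pi alpha).
- exact: addr_ge0.
- near=> n; have [w0 wn] := ws n; have [e0 en] := exp_fam_ge0 n a0; split.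
    by move=> x; rewrite mem_cat => /orP[/w0|/e0].
  by rewrite big_cat /= en lerD2r.
- move=> i.
  have -> : add_head pi alpha i = pi i + add_head (fun=> 0) alpha i.
    by case: i => [|i] /=; rewrite ?add0r ?addr0.
  under eq_fun do rewrite power_sum_cat.
  by apply: cvgD => //; exact: cvg_power_sum_exp_fam.
have [|||B' [BN' _ _ Bz']] := @fam_cvg R nat \oo _ (exp_fam alpha)
    alpha (add_head (fun=> 0) alpha) => //.
- by near=> n; have [e0 en] := exp_fam_ge0 n a0; rewrite en.
- by move=> i; exact: cvg_power_sum_exp_fam.
exists B; split=> // z; move: (Bz z) (Bz' z).
rewrite (newton_unique BN' (newton_exp alpha)) psum_exp => c1 c2.
have E : (fun n => \prod_(x <- w n ++ exp_fam alpha n) (1 - z * toC x)) =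
  (fun n => \prod_(x <- w n) (1 - z * toC x) * \prod_(x <- exp_fam alpha n) (1 - z * toC x)).
  by apply/funext => n; rewrite big_cat.
rewrite E in c1; rewrite mulrC -(norm_cvg_lim c1); apply: norm_cvg_lim.
exact: cvgM (wp z) c2.
Unshelve. all: by end_near.
Qed.
End ExponentialFactor.

(** * Nonvanishing off the half-line *)

Section Nonvanishing.
Variable R : realType.
Local Notation C := (Cplx R).

Transparent Cplx.
Lemma Im_linear_factor (z : C) (x : R) : complex.Im (1 - z * toC x) = - (x * complex.Im z).
Proof. by case: z => u v; rewrite /toC /=; ring. Qed.
Opaque Cplx.

(** A lower bound of the form [1 / (1 + c x)] multiplies well, as it costs at most a factor
    [exp (c x)]. For small [x] it comes from the distance to 1, for large [x] from the imaginary
    part, and for negative [z] the factor is at least 1. *)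
Lemma linear_factor_lower (z : C) : ~~ (0 <= z) ->
  exists2 c : R, 0 <= c & forall x, 0 <= x -> 1 <= nrm (1 - z * toC x) * (1 + c * x).
Proof.
move=> z0; pose a : R := complex.Re z; pose b : R := complex.Im z.
have [b0|b0] := eqVneq b 0.
  exists 0 => // x x0; rewrite mul0r addr0 mulr1.
  have zE : z = toC a by rewrite /toC /a; move: b0; rewrite /b; case: (z) => u v /= ->.
  move: z0; rewrite zE toC_ge0 -ltNge => a0.
  by rewrite -rmorphM -(rmorph1 (@toC R)) -rmorphB nrm_toC ger0_norm; nra.
have nb : `|b| <= nrm z by exact: nrm_geIm.
have b1 : 0 < `|b| by rewrite normr_gt0.
have nz : 0 < nrm z by rewrite (lt_le_trans b1).
(* With this value [x |b|] times [c x] equals [4 (x |z|)^2], at least 1 once [x |z|] exceeds 1/2;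
   and [|b| <= |z|] gives [c >= 4 |z|], which is enough below 1/2. *)
pose c := 4 * (nrm z ^+ 2 / `|b|).
have cz : 4 * nrm z <= c.
  by rewrite /c ler_wpM2l // ler_pdivlMr // expr2 ler_wpM2l // ltW.
have c0 : 0 <= c by rewrite (le_trans _ cz) // mulr_ge0 // ltW.
exists c => // x x0.
have [xz|xz] := leP (x * nrm z) 2^-1.
  have h : 1 - x * nrm z <= nrm (1 - z * toC x).
    rewrite lerBlDr -[in leLHS](nrm1 R).
    have -> : (1 : C) = (1 - z * toC x) + z * toC x by ring.
    rewrite (le_trans (nrmD _ _)) // nrmM nrm_toC (ger0_norm x0) [nrm z * x]mulrC.
    by rewrite lerD2r; have -> : 1 - z * toC x + z * toC x - z * toC x = 1 - z * toC x by ring.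
  apply: le_trans (_ : (1 - x * nrm z) * (1 + c * x) <= _).
    have h1 : x * nrm z * (c * x) <= 2^-1 * (c * x) by rewrite ler_wpM2r // mulr_ge0.
    have h2 : x * (4 * nrm z) <= x * c by rewrite ler_wpM2l.
    by clear -h1 h2 x0 nz; move: (nrm z) c h1 h2 nz => N c h1 h2 nz; nra.
  by rewrite ler_wpM2r // addr_ge0 // mulr_ge0.
have h : x * `|b| <= nrm (1 - z * toC x).
  apply: le_trans (nrm_geIm _).
  rewrite Im_linear_factor -/b.
  by rewrite normrN normrM (ger0_norm x0).
apply: le_trans (_ : x * `|b| * (1 + c * x) <= _); last first.
  by rewrite ler_wpM2r // addr_ge0 // mulr_ge0.
apply: le_trans (_ : x * `|b| * (c * x) <= _); last first.
  by rewrite ler_wpM2l ?mulr_ge0 // lerDr.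
have -> : x * `|b| * (c * x) = 4 * (x * nrm z) ^+ 2.
  by rewrite /c; field; rewrite gt_eqF.
nra.
Qed.

(** By [1 + c x <= exp (c x)] the product is at least [exp (- c s)], whatever the number of factors,
    so the bound survives in the limit. *)
Lemma lin_prod_lower (z : C) (s : R) : ~~ (0 <= z) ->
  exists2 e : R, 0 < e & forall v, {in v, forall x, 0 <= x} -> \sum_(x <- v) x <= s ->
    e <= nrm (\prod_(x <- v) (1 - z * toC x)).
Proof.
move=> /linear_factor_lower[c c0 cP].
exists (expR (- (c * s))); first exact: expR_gt0.
move=> v v0 vs; apply: (@le_trans _ _ (expR (- (c * \sum_(x <- v) x)))).
  by rewrite ler_expR lerN2 ler_wpM2l.
elim: v v0 {vs} => [|x v IH] v0.
  by rewrite !big_nil mulr0 oppr0 expR0 nrm1.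
have x0 : 0 <= x by rewrite v0 ?mem_head.
rewrite !big_cons nrmM mulrDr opprD expRD ler_pM ?expR_ge0 //.
  rewrite expRN -[leLHS]mul1r ler_pdivrMr ?expR_gt0 // (le_trans (cP x x0)) //.
  by rewrite ler_wpM2l ?nrm_ge0 // expR_ge1Dx.
by apply: IH => y yv; rewrite v0 // inE yv orbT.
Qed.
End Nonvanishing.

(** * The class LP(S_0) through Taylor coefficients *)

Section LaguerrePolya.
Variable R : realType.
Local Notation C := (Cplx R).
Implicit Types (B : nat -> R) (p : C -> C).

Lemma cvg_sum_pow (b : nat -> R) i : (forall j, 0 <= b j) -> cvgn (series b) ->
  cvgn (series (fun j => b j ^+ i.+1)).
Proof.
move=> b0 cb; have ndb : nondecreasing_seq (series b).
  by apply/nondecreasing_seqP => n; rewrite seriesSr lerDl.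
have bS j : b j <= limn (series b).
  apply: le_trans (nondecreasing_cvgn_le ndb cb j.+1).
  by rewrite seriesSr lerDr /series /= sumr_ge0.
have S0 : 0 <= limn (series b) := le_trans (b0 0%N) (bS 0%N).
apply: (@series_le_cvg _ _ (fun j => limn (series b) ^+ i * b j)).
- by move=> j; rewrite exprn_ge0.
- by move=> j; rewrite mulr_ge0 ?exprn_ge0.
- by move=> j; rewrite exprSr ler_wpM2r // lerXn2r ?nnegrE.
- exact: (@is_cvg_seriesZ _ b (limn (series b) ^+ i) cb).
Qed.

Lemma LP_product_fam p : LP_product p -> exists (w : nat -> seq R) (s : R) (pi : nat -> R),
  [/\ 0 <= s, forall n, {in w n, forall x, 0 <= x} /\ \sum_(x <- w n) x <= s,
    forall i, power_sum (w n) i @[n --> \oo] --> pi i &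
    forall z : C, \prod_(x <- w n) (1 - z * toC x) @[n --> \oo] --> p z].
Proof.
case=> [[t t0 pE]|[b [b0 cb pE]]].
  pose v := [seq x^-1 | x <- t].
  have v0 : {in v, forall x, 0 <= x}.
    by move=> _ /mapP[x /t0 x0 ->]; rewrite invr_ge0 ltW.
  exists (fun=> v), (\sum_(x <- v) x), (power_sum v); split=> // [|i|z].
  - by rewrite big_seq sumr_ge0.
  - exact: cvg_cst.
  - have -> : p z = \prod_(x <- v) (1 - z * toC x).
      by rewrite pE big_map; apply: eq_bigr => x _; rewrite fmorphV.
    exact: cvg_cst.
pose c j := (b j)^-1.
have c0 j : 0 <= c j by rewrite invr_ge0 ltW.
have ndc : nondecreasing_seq (series c).
  by apply/nondecreasing_seqP => n; rewrite seriesSr lerDl.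
exists (fun n => mkseq c n), (limn (series c)), (fun i => limn (series (fun j => c j ^+ i.+1))).
have sumE (f : R -> R) n : \sum_(x <- mkseq c n) f x = series (fun j => f (c j)) n.
  by rewrite big_map /series /= /index_iota subn0.
split.
- by apply: (le_trans _ (nondecreasing_cvgn_le ndc cb 0%N)); rewrite /series /= sumr_ge0.
- move=> n; split=> [_ /mapP[j _ ->]//|].
  by rewrite (sumE id); exact: (nondecreasing_cvgn_le ndc cb n).
- move=> i; rewrite /power_sum; under eq_fun do rewrite (sumE (fun x => x ^+ i.+1)).
  exact: cvg_sum_pow.
- move=> z; have := pE z.
  have -> // : (fun n => \prod_(j < n) (1 - z / toC (b j))) =
               (fun n => \prod_(x <- mkseq c n) (1 - z * toC x)).
  apply/funext => n; rewrite big_map -(big_mkord xpredT (fun j => 1 - z / toC (b j))).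
  by rewrite /index_iota subn0; apply: eq_bigr => j _; rewrite /c fmorphV.
Qed.

(** The zeros are the inverses of the [y j], which may be 0 from some index on. As [y] decreases,
    its positive terms form an initial segment: a finite one gives the finite product, otherwise all
    terms can be inverted. *)
Lemma LP_product_decreasing (y : nat -> R) p : (forall j, 0 <= y j) ->
  (forall j, y j.+1 <= y j) -> cvgn (series y) ->
  (forall z : C, \prod_(x <- mkseq y n) (1 - z * toC x) @[n --> \oo] --> p z) -> LP_product p.
Proof.
move=> y0 yd cy yp; have [ypos|] := pselect (forall j, 0 < y j).
  right; exists (fun j => (y j)^-1); split.
  - by move=> j; rewrite invr_gt0.
  - by under eq_fun do rewrite invrK; exact: cy.
  - move=> z; have := yp z.
    have -> // : (fun n => \prod_(x <- mkseq y n) (1 - z * toC x)) =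
                 (fun n => \prod_(j < n) (1 - z / toC (y j)^-1)).
    apply/funext => n; rewrite big_map -(big_mkord xpredT (fun j => 1 - z / toC (y j)^-1)).
    by rewrite /index_iota subn0; apply: eq_bigr => j _; rewrite fmorphV invrK.
move=> /existsNP[j0 /negP]; rewrite -leNgt => yj0; left.
have exJ : exists j, y j <= 0 by exists j0.
pose J := ex_minn exJ.
have [yJ Jmin] : y J <= 0 /\ forall j, y j <= 0 -> (J <= j)%N by rewrite /J; case: ex_minnP.
have yz j : (J <= j)%N -> y j = 0.
  move=> Jj; apply/eqP; rewrite eq_le y0 andbT (le_trans _ yJ) //.
  rewrite -(subnKC Jj); elim: (j - J)%N => [|m IH]; first by rewrite addn0.
  by rewrite addnS (le_trans (yd _)).
exists [seq (y j)^-1 | j <- iota 0 J].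
  move=> _ /mapP[j + ->]; rewrite mem_iota /= add0n invr_gt0 => jJ.
  by rewrite ltNge; apply/negP => /Jmin; rewrite leqNgt jJ.
move=> z; apply: (norm_cvg_unique (yp z)); apply: cvg_near_cst; near=> n.
have Jn : (J <= n)%N by near: n; exact: nbhs_infty_ge.
rewrite !big_map -[n](subnKC Jn) iotaD big_cat /= [X in _ * X]big1_seq ?mulr1 => [|j].
  by apply: eq_bigr => j _; rewrite fmorphV invrK.
by rewrite mem_iota add0n => /andP[_ /andP[Jj _]]; rewrite yz // rmorph0 mulr0 subr0.
Unshelve. all: by end_near.
Qed.

(* Taylor coefficients of the members of LP(S_0) with value 1 at 0. *)
Definition lp_seq B := exists (w : nat -> seq R) (s : R), [/\ 0 <= s,
  forall n, {in w n, forall x, 0 <= x} /\ \sum_(x <- w n) x <= s,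
  forall k, (lin_prod (w n))`_k @[n --> \oo] --> B k,
  forall k, `|B k| <= s ^+ k / k`!%:R &
  exists (alpha : R) p, [/\ 0 <= alpha, LP_product p &
    forall z : C, psum (fun k => toC (B k)) z = cexp (- toC alpha * z) * p z]].

Lemma lp_seq_cat (w : nat -> seq R) s alpha pi p : 0 <= s -> 0 <= alpha ->
  (forall n, {in w n, forall x, 0 <= x} /\ \sum_(x <- w n) x <= s) ->
  (forall i, power_sum (w n) i @[n --> \oo] --> pi i) ->
  (forall z : C, \prod_(x <- w n) (1 - z * toC x) @[n --> \oo] --> p z) ->
  LP_product p ->
  exists B, [/\ lp_seq B, newton (add_head pi alpha) B &
    forall z : C, psum (fun k => toC (B k)) z = cexp (- toC alpha * z) * p z].
Proof.
move=> s0 a0 ws wpi wp lp; have [B [BN BE Bb Bz]] := fam_exp s0 a0 ws wpi wp.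
exists B; split=> //; exists (fun n => w n ++ exp_fam alpha n), (s + alpha); split => //.
- exact: addr_ge0.
- move=> n; have [w0 wn] := ws n; have [e0 en] := exp_fam_ge0 n a0; split.
    by move=> x; rewrite mem_cat => /orP[/w0|/e0].
  by rewrite big_cat /= en lerD2r.
- by exists alpha, p.
Qed.

Lemma lp_seq_product alpha p : 0 <= alpha -> LP_product p ->
  exists2 B, lp_seq B &
    forall z : C, psum (fun k => toC (B k)) z = cexp (- toC alpha * z) * p z.
Proof.
move=> a0 lp; have [w [s [pi [s0 ws wpi wp]]]] := LP_product_fam lp.
by have [B [? _ ?]] := lp_seq_cat s0 a0 ws wpi wp lp; exists B.
Qed.

Lemma fast_decay_lp_seq B : lp_seq B -> fast_decay (fun k => toC (B k)).
Proof. by move=> [w [s [s0 _ _ Bs _]]]; exact: fast_decay_exp_bound Bs. Qed.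

Lemma lp_seq_neq0 B (z : C) : lp_seq B -> ~~ (0 <= z) -> psum (fun k => toC (B k)) z != 0.
Proof.
move=> [w [s [s0 ws wB Bs _]]] z0.
have [e e0 eP] := lin_prod_lower s z0.
have [K KP] := exp_term_bounded s0 (mulr_ge0 (ler0n R 2) (nrm_ge0 z)).
have cz : psum (fun k => toC (lin_prod (w n))`_k) z @[n --> \oo] --> psum (fun k => toC (B k)) z.
  apply: (@psum_tannery _ _ _ _ (fun n k => toC (lin_prod (w n))`_k) _ _ K (nrm z)) => //.
  - exact: nrm_ge0.
  - near=> n => k; rewrite (le_trans _ (KP k)) // nrm_toC.
    have [w0 wn] := ws n.
    by rewrite ler_wpM2r ?exprn_ge0 ?mulr_ge0 ?nrm_ge0 // coef_lin_prod_bound.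
  - by move=> k; exact: cvg_toC.
apply/eqP => B0; move: cz; rewrite B0 => /cvg_nrmP c0.
have : \forall n \near \oo, nrm (psum (fun k => toC (lin_prod (w n))`_k) z - 0) < e.
  exact: (cvgr_lt _ c0).
move=> [n _ /(_ n (leqnn n))] /=; have [w0 wn] := ws n.
by rewrite subr0 psum_map_poly horner_lin_prod ltNge eP.
Unshelve. all: by end_near.
Qed.

Transparent Cplx.
Lemma Im_toC_sub (x : R) (z : C) : complex.Im (toC x - z) = - complex.Im z.
Proof. by case: z => u v; rewrite /toC /= add0r. Qed.

Lemma Im_eq0 (z : C) : complex.Im z = 0 -> z = toC (complex.Re z).
Proof. by case: z => u v /= ->. Qed.
Opaque Cplx.

Lemma psum_real (a : nat -> R) : fast_decay (fun k => toC (a k)) ->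
  real_function (psum (fun k => toC (a k))).
Proof.
move=> fa x; set z := psum _ _.
have [Sx Sc] : exists S : nat -> R, toC (S n) @[n --> \oo] --> z.
  exists (series (fun k => a k * x ^+ k)); have := cvg_psum (z := toC x) fa.
  have -> // : pseriesC (fun k => toC (a k)) (toC x) =
            (fun n => toC (series (fun k => a k * x ^+ k) n)).
  apply/funext => n; rewrite /pseriesC /series /= rmorph_sum; apply: eq_bigr => k _.
  by rewrite rmorphM rmorphXn.
have imz : complex.Im z = 0.
  apply/eqP; rewrite -normr_eq0 eq_le normr_ge0 andbT.
  apply/ler_addgt0Pr => e e0; rewrite add0r; move/cvg_nrmP: Sc => c0.
  near \oo => n; apply: (@le_trans _ _ (nrm (toC (Sx n) - z))).
    apply: le_trans (nrm_geIm _).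
    rewrite Im_toC_sub.
    by rewrite normrN.
  by apply: ltW; near: n; exact: (cvgr_lt _ c0).
by rewrite (Im_eq0 imz) realE -(rmorph0 (@toC R)) !ler_toC le_total.
Unshelve. all: by end_near.
Qed.

Lemma lp_seq_LP_S0 B : lp_seq B -> LP_S0 (psum (fun k => toC (B k))).
Proof.
move=> lB; have fB := fast_decay_lp_seq lB.
split; [by move=> z; exact: derivable_psum|exact: psum_real|].
move: lB => [_ [_ [_ _ _ _ [alpha [p [a0 lp pE]]]]]].
exists 1, 0%N, alpha, p; split=> // z.
by rewrite rmorph1 expr0 !mul1r pE.
Qed.
End LaguerrePolya.
(** * Compactness *)

Section PowerSums.
Variable R : realType.
Implicit Types (v : seq R) (x K : R).

Lemma power_sum_split v J i :
  power_sum v i = \sum_(j < J) v`_j ^+ i.+1 + power_sum (drop J v) i.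
Proof.
elim: J v => [|J IH] [|x v]; rewrite ?drop0 ?big_ord0 ?add0r //.
  (* [J] may exceed the length: the default 0 of [nth] contributes [0 ^+ i.+1 = 0]. *)
  rewrite /power_sum !big_nil addr0 big1 // => j _; by rewrite nth_nil expr0n.
by rewrite /= big_ord_recl /= -addrA -IH /power_sum big_cons.
Qed.

(** Together with the [J] terms dropped before it, [x] makes [J.+1] terms, all at least [x]. *)
Lemma sorted_drop_le v J x : sorted >=%R v -> {in v, forall y, 0 <= y} ->
  x \in drop J v -> x * J.+1%:R <= \sum_(y <- v) y.
Proof.
elim: J v => [|J IH] [|y v] // sv v0.
  rewrite drop0 mulr1 => xv; rewrite (big_rem x) //= lerDl big_seq sumr_ge0 // => z zv.
  exact: v0 (mem_rem (s := y :: v) zv).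
move=> /= xv; have xv' : x \in v by exact: mem_drop xv.
rewrite big_cons -natr1 mulrDr mulr1 addrC lerD //.
  have := order_path_min (rev_trans le_trans) sv => /allP /(_ x xv'); exact.
by apply: IH => //; [exact: path_sorted sv|move=> z zv; rewrite v0 // inE zv orbT].
Qed.

Lemma power_sum_le v i b : {in v, forall x, 0 <= x <= b} ->
  power_sum v i <= b ^+ i * \sum_(x <- v) x.
Proof.
move=> vb; rewrite /power_sum mulr_sumr big_seq [leRHS]big_seq; apply: ler_sum => x xv.
have /andP[x0 xb] := vb x xv.
by rewrite exprSr ler_wpM2r // lerXn2r ?nnegrE // (le_trans x0).
Qed.

Lemma power_sum_ge0 v i : {in v, forall x, 0 <= x} -> 0 <= power_sum v i.
Proof. by move=> v0; rewrite /power_sum big_seq sumr_ge0 // => x xv; rewrite exprn_ge0 // v0. Qed.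

(* In decreasing order the [j]-th term is at most [K / j.+1], hence power sums of
   exponent at least 2 converge to those of the limits [y j]; the mass lost by the
   first power sum produces the exponential factor. *)
Lemma lin_prod_ultra (U : set_system nat) (v_ : nat -> seq R) K : UltraFilter U -> 0 <= K ->
  (\forall n \near U, {in v_ n, forall x, 0 <= x} /\ \sum_(x <- v_ n) x <= K) ->
  exists B pi, [/\ lp_seq B, newton pi B, forall k, (lin_prod (v_ n))`_k @[n --> U] --> B k &
    forall i, power_sum (v_ n) i @[n --> U] --> pi i].
Proof.
move=> UU K0 vK; have PU := @ultra_proper _ U UU.
pose u n := sort >=%R (v_ n).
have pu n : perm_eq (u n) (v_ n) by rewrite perm_sort.
have su n : sorted >=%R (u n) by apply: sort_sorted => x y; rewrite orbC; exact: le_total.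
have uK : \forall n \near U, {in u n, forall x, 0 <= x} /\ \sum_(x <- u n) x <= K.
  apply: filterS vK => n [v0 vs]; split; last by rewrite (perm_big _ (pu n)).
  by move=> x; rewrite (perm_mem (pu n)) => /v0.
have psE n i : power_sum (v_ n) i = power_sum (u n) i.
  by rewrite /power_sum; apply/esym/perm_big.
have uj n j : {in u n, forall x, 0 <= x} -> 0 <= (u n)`_j.
  move=> u0; have [jn|jn] := ltnP j (size (u n)); last by rewrite nth_default.
  by rewrite u0 // mem_nth.
have drop_le n J x : {in u n, forall x, 0 <= x} -> \sum_(x <- u n) x <= K ->
    x \in drop J (u n) -> 0 <= x <= K / J.+1%:R.
  move=> u0 us xu; rewrite u0 ?(mem_drop xu) //= ler_pdivlMr //.
  exact: le_trans (sorted_drop_le (su n) u0 xu) us.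
have /choice[y yP] : forall j, exists l : R, (u n)`_j @[n --> U] --> l.
  move=> j.
  apply: (@ultra_bounded_cvg _ _ _ K); apply: filterS uK => n [u0 us].
  rewrite ger0_norm ?uj //; have [jn|jn] := ltnP j (size (u n)); last by rewrite nth_default.
  have : (u n)`_j \in drop 0 (u n) by rewrite drop0 mem_nth.
  by move=> /(drop_le _ _ _ u0 us) /andP[_]; rewrite divr1.
have /choice[pi piP] : forall i, exists l : R, power_sum (u n) i @[n --> U] --> l.
  move=> i.
  apply: (@ultra_bounded_cvg _ _ _ (K ^+ i * K)); apply: filterS uK => n [u0 us].
  rewrite ger0_norm ?power_sum_ge0 // (le_trans (power_sum_le (b := K) _ _)) //.
    by move=> x xu; have := drop_le n 0%N x u0 us; rewrite drop0 divr1; apply.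
  by rewrite ler_wpM2l ?exprn_ge0.
have y0 j : 0 <= y j.
  apply: (@closed_cvg _ _ U _ (fun n => (u n)`_j) [set t | 0 <= t]); first exact: closed_ge.
    by apply: filterS uK => n [u0 _]; exact: uj.
  exact: yP.
have yd j : y j.+1 <= y j.
  rewrite -subr_ge0.
  apply: (@closed_cvg _ _ U _ (fun n => (u n)`_j - (u n)`_j.+1) [set t | 0 <= t]); first exact: closed_ge.
    apply: filterS uK => n [u0 _] /=; rewrite subr_ge0.
    have [jn|jn] := ltnP j.+1 (size (u n)); last by rewrite (nth_default _ jn) uj.
    by apply: (sorted_leq_nth (rev_trans le_trans) le_refl 0 (su n)) => //; exact: ltnW.
  by apply: cvgB; exact: yP.
have cS i J : \sum_(j < J) (u n)`_j ^+ i.+1 @[n --> U] --> series (fun j => y j ^+ i.+1) J.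
  by rewrite /series /= big_mkord; apply: cvg_sumr => j _; exact: cvg_exprn.
have Sle i J : series (fun j => y j ^+ i.+1) J <= pi i.
  rewrite -subr_ge0.
  apply: (@closed_cvg _ _ U _ (fun n => power_sum (u n) i - \sum_(j < J) (u n)`_j ^+ i.+1)
     [set t | 0 <= t]); first exact: closed_ge.
    apply: filterS uK => n [u0 _] /=; rewrite (power_sum_split _ J) addrAC subrr add0r.
    by rewrite power_sum_ge0 // => x xu; rewrite u0 // (mem_drop xu).
  by apply: cvgB; [exact: piP|exact: cS].
(* Terms beyond the first [J] are at most [K / J.+1], so their contribution is small uniformly in
   [n]. This needs an exponent at least 2: with exponent 1 the factor [(K / J.+1)] would be
   absent. *)
have Sge i J : pi i.+1 <= series (fun j => y j ^+ i.+2) J + (K / J.+1%:R) ^+ i.+1 * K.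
  rewrite -subr_ge0.
  apply: (@closed_cvg _ _ U _ (fun n => \sum_(j < J) (u n)`_j ^+ i.+2 + (K / J.+1%:R) ^+ i.+1 * K
     - power_sum (u n) i.+1) [set t | 0 <= t]); first exact: closed_ge.
    apply: filterS uK => n [u0 us] /=; rewrite (power_sum_split _ J) opprD addrA.
    rewrite [_ + _ - \sum_(_ < _) _]addrAC subrr add0r subr_ge0.
    rewrite (le_trans (power_sum_le (b := K / J.+1%:R) _ _)) //.
      by move=> x; exact: drop_le.
    rewrite ler_wpM2l ?exprn_ge0 ?divr_ge0 // (le_trans _ us) //.
    rewrite -[in leRHS](cat_take_drop J (u n)) big_cat /= lerDr big_seq sumr_ge0 // => x xu.
    by rewrite u0 // (mem_take xu).
  by apply: cvgB; [apply: cvgD; [exact: cS|exact: cvg_cst]|exact: piP].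
have nd i : nondecreasing_seq (series (fun j => y j ^+ i.+1)).
  by apply/nondecreasing_seqP => n; rewrite seriesSr lerDl exprn_ge0.
have cy : cvgn (series (fun j => y j ^+ 1)).
  apply: nondecreasing_is_cvgn; first exact: nd.
  by exists (pi 0%N) => _ [J _ <-]; exact: Sle.
pose Y := limn (series (fun j => y j ^+ 1)).
have YP : Y <= pi 0%N by apply: limr_le => //; near=> J; exact: Sle.
have cpi i : series (fun j => y j ^+ i.+2) J @[J --> \oo] --> pi i.+1.
  apply: (@squeeze_cvgr _ _ _ _ (fun J => pi i.+1 - (K / J.+1%:R) ^+ i.+1 * K) (fun=> pi i.+1)).
  - near=> J; rewrite Sle andbT lerBlDr; exact: Sge.
  - have : pi i.+1 - (K / J.+1%:R) ^+ i.+1 * K @[J --> \oo] --> pi i.+1 - 0 ^+ i.+1 * K.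
      apply: cvgB; first exact: cvg_cst.
      apply: cvgM; last exact: cvg_cst.
      by apply: cvg_exprn; exact: cvg_div_n.
    by rewrite expr0n mul0r subr0.
  - exact: cvg_cst.
pose pi' i := if i is 0%N then Y else pi i.
have sumE (f : R -> R) n : \sum_(x <- mkseq y n) f x = series (fun j => f (y j)) n.
  by rewrite big_map /series /= /index_iota subn0.
have wps i : power_sum (mkseq y n) i @[n --> \oo] --> pi' i.
  rewrite /power_sum; under eq_fun do rewrite (sumE (fun x => x ^+ i.+1)).
  by case: i => [|i]; [exact: cy|exact: cpi].
have ws n : {in mkseq y n, forall x, 0 <= x} /\ \sum_(x <- mkseq y n) x <= Y.
  split=> [_ /mapP[j _ ->] //|]; rewrite (sumE id).
  exact: (nondecreasing_cvgn_le (nd 0%N) cy n).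
have Y0 : 0 <= Y by have [_] := ws 0%N; rewrite big_nil.
have [B1 [_ _ _ B1z]] := fam_cvg _ Y0 (nearW _ ws) wps.
have lp : LP_product (psum (fun k => toC (B1 k))).
  by apply: (LP_product_decreasing y0 yd) => //; exact: cy.
have beta0 : 0 <= pi 0%N - Y by rewrite subr_ge0.
have [B [lB BN _]] := lp_seq_cat Y0 beta0 ws wps B1z lp.
have piE : add_head pi' (pi 0%N - Y) = pi.
  by apply/funext => -[|i] //=; rewrite addrC subrK.
rewrite piE in BN.
have vps i : power_sum (v_ n) i @[n --> U] --> pi i.
  by under eq_fun do rewrite psE; exact: piP.
(* [B] arises along [\oo] from the family built on [y], [B'] along [U] from the given lists; sharing
   the power sums [pi], they coincide. *)
have [B' [BN' cB' _ _]] := fam_cvg _ K0 vK vps.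
by exists B, pi; split=> // k; rewrite (newton_unique BN BN').
Unshelve. all: by end_near.
Qed.
End PowerSums.

(** * Limits of factorisations *)

Section FactorLimit.
Variable R : realType.
Local Notation C := (Cplx R).

(** The limits of [P_] and of the power sums are returned as well, because the blow-up argument
    computes the limit of the weight from them. *)
Lemma factor_limit_bounded (U : set_system nat) M (P_ : nat -> {poly R}) (v_ : nat -> seq R)
    (a : nat -> R) (K : R) : UltraFilter U -> 0 <= K ->
  (\forall n \near U, (size (P_ n) <= M.+1)%N /\ forall k, `|(P_ n)`_k| <= K) ->
  (\forall n \near U, {in v_ n, forall x, 0 <= x} /\ \sum_(x <- v_ n) x <= K) ->
  (forall k, (P_ n * lin_prod (v_ n))`_k @[n --> U] --> a k) ->
  exists (P : {poly R}) (B pi : nat -> R), [/\ (size P <= M.+1)%N, lp_seq B, newton pi B, a = conv P B &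
    (forall k, (P_ n)`_k @[n --> U] --> P`_k) /\
    forall i, power_sum (v_ n) i @[n --> U] --> pi i].
Proof.
move=> UU K0 PK vK ca; have PU := @ultra_proper _ U UU.
have [B [pi [lB BN cB cpi]]] := lin_prod_ultra UU K0 vK.
have /choice[l lP] : forall k, exists l : R, (P_ n)`_k @[n --> U] --> l.
  by move=> k; apply: (@ultra_bounded_cvg _ _ _ K) => //; apply: filterS PK => n [_].
have cP k : (P_ n)`_k @[n --> U] --> (\poly_(k < M.+1) l k)`_k.
  rewrite coef_poly; case: ltnP => [_ //|Mk]; apply: cvg_near_cst.
  by apply: filterS PK => n [sP _]; rewrite nth_default // (leq_trans sP).
exists (\poly_(k < M.+1) l k), B, pi; split=> //.
apply/funext => k; apply: (norm_cvg_unique (ca k)).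
rewrite /conv /=; under eq_fun do rewrite coefM.
by apply: cvg_sumr => i _; apply: cvgM.
Qed.

Lemma lin_prod_scale (t : R) (v : seq R) k :
  (lin_prod [seq t * x | x <- v])`_k = t ^+ k * (lin_prod v)`_k.
Proof.
elim: v k => [|x v IH] k.
  by rewrite /lin_prod /= big_nil coef1; case: k => [|k]; rewrite ?expr0 ?mulr1 ?mulr0.
rewrite /= !coef_lin_prod_cons IH; case: k => [|k]; first by rewrite !mulr0 !subr0.
by rewrite IH exprS; ring.
Qed.

(* [P (t X)] *)
Definition scale_poly M (t : R) (P : {poly R}) := \poly_(k < M.+1) (P`_k * t ^+ k).

Lemma coef_scale_poly M t (P : {poly R}) k : (size P <= M.+1)%N ->
  (scale_poly M t P)`_k = P`_k * t ^+ k.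
Proof.
by move=> sP; rewrite coef_poly; case: ltnP => // Mk; rewrite nth_default ?mul0r // (leq_trans sP).
Qed.

Lemma coef_scaleM M t (P : {poly R}) (v : seq R) k : (size P <= M.+1)%N ->
  (scale_poly M t P * lin_prod [seq t * x | x <- v])`_k = (P * lin_prod v)`_k * t ^+ k.
Proof.
move=> sP; rewrite !coefM mulr_suml; apply: eq_bigr => i _.
have -> : t ^+ k = t ^+ i * t ^+ (k - i) by rewrite -exprD subnKC // -ltnS.
by rewrite coef_scale_poly // lin_prod_scale; ring.
Qed.

(** Measures both factors after the substitution of [t X] for the variable. The constant
    coefficients, normalised to 1, are left out, so that the weight vanishes at [t = 0]; the second
    factor is controlled by the sum of its [x] alone. *)
Definition size_weight M (P : {poly R}) (v : seq R) (t : R) :=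
  \sum_(k < M) `|P`_k.+1| * t ^+ k.+1 + (\sum_(x <- v) x) * t.

(** Intermediate value theorem, as the weight is 0 at 0 and exceeds 1 at 1; when it does not exceed
    1 there, [t = 1] is taken. *)
Lemma balanced_scale M (P : {poly R}) (v : seq R) : {in v, forall x, 0 <= x} ->
  exists t : R, [/\ 0 < t, t <= 1, size_weight M P v t <= 1 & t = 1 \/ size_weight M P v t = 1].
Proof.
move=> v0; have [w1|w1] := leP (size_weight M P v 1) 1.
  by exists 1; split=> //; left.
pose F : {poly R} := \sum_(k < M) (`|P`_k.+1| *: 'X^(k.+1)) + (\sum_(x <- v) x) *: 'X - 1.
have FE t : F.[t] = size_weight M P v t - 1.
  rewrite /F !hornerE horner_sum; congr (_ + _ - _).
  by apply: eq_bigr => k _; rewrite hornerZ hornerXn.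
have F0 : F.[0] = - 1.
  rewrite FE /size_weight mulr0 big1 ?add0r ?sub0r // => k _.
  by rewrite expr0n mulr0.
have [||t /andP[t0 t1] /rootP Ft] := @poly_ivt R F 0 1; first exact: ler01.
  by rewrite F0 FE oppr_le0 ler01 /= subr_ge0 ltW.
have wt : size_weight M P v t = 1 by apply/eqP; rewrite -subr_eq0 -FE Ft.
exists t; split=> //; [|by rewrite wt|by right].
rewrite lt_neqAle t0 andbT; apply: contra_eq_neq Ft => <-.
by rewrite F0 oppr_eq0 oner_eq0.
Qed.

Lemma poly_no_root_size (P : {poly R}) : (forall z : C, (map_poly (@toC R) P).[z] != 0) ->
  (size P <= 1)%N.
Proof.
move=> Pz; rewrite -(size_map_poly (@toC R)); have [[|w ws] pE] := poly_split (map_poly (@toC R) P).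
  by rewrite pE big_nil (leq_trans (size_scale_leq _ _)) // size_poly1.
by have := Pz w; rewrite pE big_cons hornerZ hornerM hornerXsubC subrr mul0r mulr0 eqxx.
Qed.

(* If the factors blew up, shrinking the variable by [t n --> 0] would normalise
   them to [size_weight = 1] while the product tends to 1; a limit [P * B = 1] has
   [P] without complex root, so [P = 1] and [B = 1], contradicting the weight. *)
Theorem factor_limit M (P_ : nat -> {poly R}) (v_ : nat -> seq R) (a : nat -> R) :
  (forall n, (size (P_ n) <= M.+1)%N) -> (forall n, (P_ n)`_0 = 1) ->
  (forall n, {in v_ n, forall x, 0 <= x}) ->
  (forall k, (P_ n * lin_prod (v_ n))`_k @[n --> \oo] --> a k) ->
  exists (P : {poly R}) (B : nat -> R), [/\ (size P <= M.+1)%N, lp_seq B & a = conv P B].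
Proof.
move=> sP P0 v0 ca.
have [U [UU ooU]] := ultraFilterLemma eventually_filter.
have PU := @ultra_proper _ U UU.
have caU k : (P_ n * lin_prod (v_ n))`_k @[n --> U] --> a k.
  exact: cvg_trans (cvg_app _ ooU) (ca k).
have /choice[t tP] := fun n => balanced_scale M (P_ n) (v0 n).
have [T cT] : exists T : R, t n @[n --> U] --> T.
  apply: (@ultra_bounded_cvg _ _ _ 1) => //; near=> n; have [t0 t1 _ _] := tP n.
  by rewrite gtr0_norm.
have T0 : 0 <= T.
  apply: (@closed_cvg _ _ U _ t [set y | 0 <= y]) cT; first exact: closed_ge.
  by near=> n; have [/ltW] := tP n.
have tv0 n : {in [seq t n * x | x <- v_ n], forall x, 0 <= x}.
  by move=> _ /mapP[x xv ->]; have [/ltW t0 _ _ _] := tP n; exact: mulr_ge0 t0 (v0 n x xv).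
have tvE n : \sum_(x <- [seq t n * x | x <- v_ n]) x = (\sum_(x <- v_ n) x) * t n.
  by rewrite big_map mulr_suml; apply: eq_bigr => x _; rewrite mulrC.
have sv0 n : 0 <= \sum_(x <- v_ n) x by rewrite big_seq sumr_ge0 // => x /v0.
have Pk n k : `|(P_ n)`_k| * t n ^+ k <= 1.
  have [t0 t1 wt _] := tP n; case: k => [|k]; first by rewrite P0 normr1 mulr1.
  have [kM|Mk] := ltnP k M; last by rewrite nth_default ?normr0 ?mul0r // (leq_trans (sP n)).
  apply: le_trans wt; rewrite /size_weight (bigD1 (Ordinal kM)) //= -addrA lerDl addr_ge0 //.
    by apply: sumr_ge0 => i _; rewrite mulr_ge0 // exprn_ge0 // ltW.
  by rewrite mulr_ge0 // ltW.
have Sk n : (\sum_(x <- v_ n) x) * t n <= 1.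
  have [t0 t1 wt _] := tP n; apply: le_trans wt; rewrite /size_weight lerDr sumr_ge0 // => i _.
  by rewrite mulr_ge0 // exprn_ge0 // ltW.
(* If [T = 0] the scaled coefficients tend to [a k * 0 ^+ k], that is to the constant 1, which leads
   to the contradiction. If [T > 0] the factors were bounded without scaling. *)
move: T0; rewrite le_eqVlt => /orP[/eqP Tz|Tpos].
  have [|||P [B [pi [sPl lB BN aE [cP cpi]]]]] := @factor_limit_bounded U M
    (fun n => scale_poly M (t n) (P_ n)) (fun n => [seq t n * x | x <- v_ n])
    (fun k => a k * 0 ^+ k) 1 UU ler01.
  - near=> n; split=> [|k]; first exact: size_poly.
    have [/ltW t0 _ _ _] := tP n.
    by rewrite coef_scale_poly // normrM normrX (ger0_norm t0).
  - by near=> n; rewrite tvE.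
  - move=> k; under eq_fun do rewrite coef_scaleM //.
    by apply: cvgM => //; apply: cvg_exprn; rewrite Tz.
  have aE0 : a 0%N = 1.
    apply: (norm_cvg_unique (ca 0%N)); apply: cvg_near_cst; near=> n.
    rewrite coefM big_ord1 /= P0 mul1r; by have [-> _] := newton_lin_prod (v_ n).
  have fB := fast_decay_lp_seq lB.
  have convE : conv P B = (fun k => (1 : {poly R})`_k).
    rewrite -aE; apply/funext => -[|k]; rewrite coef1 ?expr0 ?aE0 ?mulr1 //.
    by rewrite expr0n mulr0.
  have sP1 : (size P <= 1)%N.
    apply: poly_no_root_size => z; have [_ /(_ z)] := psum_conv (map_poly (@toC R) P) fB.
    rewrite conv_toC convE psum_map_poly rmorph1 hornerC => h; apply/eqP => Pz0.
    by move: h; rewrite Pz0 mul0r => /eqP; rewrite oner_eq0.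
  have P01 : P`_0 = 1.
    apply: (norm_cvg_unique (cP 0%N)); apply: cvg_near_cst; near=> n.
    by rewrite coef_scale_poly // P0 expr0 mulr1.
  have Pk0 k : P`_k.+1 = 0 by rewrite nth_default // (leq_trans sP1).
  (* Newton's first identity reads [B 1 = - pi 0], so the sum of the scaled [v_ n] tends to 0 along
     with the coefficients of the polynomial factor. *)
  have B1 : B 1%N = 0.
    have := congr1 (fun f => f 1%N) convE; rewrite /conv big_ord_recl big_ord1 /=.
    by rewrite P01 mul1r Pk0 mul0r addr0 coef1.
  have pi0 : pi 0%N = 0.
    have [B0 /(_ 0%N)] := BN; rewrite big_ord1 /= B1 B0 mulr0 mulr1 => /eqP.
    by rewrite eq_sym oppr_eq0 => /eqP.
  have cw : size_weight M (P_ n) (v_ n) (t n) @[n --> U] --> (0 : R).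
    have -> : (fun n => size_weight M (P_ n) (v_ n) (t n)) =
      (fun n => \sum_(k < M) `|(scale_poly M (t n) (P_ n))`_k.+1| +
                power_sum [seq t n * x | x <- v_ n] 0).
      apply/funext => n; rewrite /size_weight /power_sum.
      have [/ltW t0 _ _ _] := tP n.
      under [in RHS]eq_bigr => k _ do rewrite coef_scale_poly // normrM normrX (ger0_norm t0).
      by congr (_ + _); rewrite -tvE; apply: eq_bigr => x _; rewrite expr1.
    have Z : \sum_(k < M) `|P`_k.+1| + pi 0%N = 0.
      by rewrite pi0 addr0 big1 // => k _; rewrite Pk0 normr0.
    suff : \sum_(k < M) `|(scale_poly M (t n) (P_ n))`_k.+1| +
        power_sum [seq t n * x | x <- v_ n] 0 @[n --> U] -->
        \sum_(k < M) `|P`_k.+1| + pi 0%N by rewrite Z.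
    by apply: cvgD => //; apply: cvg_sumr => k _; exact: cvg_norm (cP k.+1).
  (* Along [U] the scale [t n] is eventually below 1, and then the weight is exactly 1. *)
  exfalso; have w1 : size_weight M (P_ n) (v_ n) (t n) @[n --> U] --> (1 : R).
    apply: cvg_near_cst; have tl : \forall n \near U, t n < 1.
      by apply: (cvgr_lt _ cT); rewrite -Tz ltr01.
    by apply: filterS tl => n tn; have [_ _ _ [tn1|//]] := tP n; rewrite tn1 ltxx in tn.
  have e01 : (0 : R) = 1 := norm_cvg_unique cw w1.
  by have := oner_neq0 R; rewrite -e01 eqxx.
(* Along [U] eventually [t n > T / 2], so [c] bounds [(t n)^-1]. Undoing the scaling costs [c ^+ k]
   with [k <= M] on coefficients and [c] on the sum; [c ^+ M.+1] covers both, even for [M = 0]. *)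
pose c := 2 / T.
have T1 : T <= 1.
  apply: (@closed_cvg _ _ U _ t [set y | y <= 1]) cT; first exact: closed_le.
  by near=> n; have [_] := tP n.
have c1 : 1 <= c by rewrite /c ler_pdivlMr // mul1r (le_trans T1) // ler1n.
have tc : \forall n \near U, (t n)^-1 <= c.
  have tT : \forall n \near U, T / 2 < t n.
    by apply: (cvgr_gt _ cT); rewrite ltr_pdivrMr // ltr_pMr // ltr1n.
  apply: filterS tT => n tn; rewrite /c -invf_div lef_pV2 ?posrE ?ltW //.
    by have [] := tP n.
  by rewrite divr_gt0.
have [||||P [B [pi [sPl lB _ aE _]]]] := @factor_limit_bounded U M P_ v_ a (c ^+ M.+1) UU.
- by rewrite exprn_ge0 // (le_trans ler01).
- apply: filterS tc => n tn; split=> // k; have [t0 _ _ _] := tP n.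
  have [Mk|kM] := ltnP M k.
    rewrite nth_default ?normr0 ?exprn_ge0 ?(le_trans ler01) //.
    exact: leq_trans (sP n) Mk.
  apply: (@le_trans _ _ ((t n)^-1 ^+ k)).
    by rewrite exprVn -[leRHS]mul1r ler_pdivlMr ?exprn_gt0.
  apply: (@le_trans _ _ (c ^+ k)).
    by rewrite lerXn2r ?nnegrE ?invr_ge0 ?(ltW t0) // (le_trans ler01).
  by rewrite ler_weXn2l // ltnW.
- apply: filterS tc => n tn; split; first exact: v0.
  have [t0 _ _ _] := tP n; apply: (@le_trans _ _ (t n)^-1).
    by rewrite -[leRHS]mul1r ler_pdivlMr.
  by rewrite (le_trans tn) // ler_eXnr // (le_trans ler01).
- exact: caU.
by exists P, B.
Unshelve. all: by end_near.
Qed.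
End FactorLimit.
(** * Appell polynomials *)

Section AppellAlgebra.
Variable K : numFieldType.
Implicit Types (a b : nat -> K).

Lemma coef_appell a n j :
  (appell a n)`_j = if (j <= n)%N then n`!%:R / j`!%:R * a (n - j)%N else 0.
Proof.
rewrite /appell coef_sum; case: leqP => [jn|nj].
  have jn' : (n - j < n.+1)%N by rewrite ltnS leq_subr.
  rewrite (bigD1 (Ordinal jn')) //= coefZ coefXn subKn // eqxx mulr1 big1 ?addr0 // => i /eqP ij.
  rewrite coefZ coefXn; case: eqP => [ji|_]; last by rewrite mulr0.
  by case: ij; apply: val_inj; rewrite /= ji subKn // -ltnS.
rewrite big1 // => i _; rewrite coefZ coefXn; case: eqP => [ji|_]; last by rewrite mulr0.
by move: nj; rewrite ji ltnNge leq_subr.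
Qed.

Lemma size_appell a n : (size (appell a n) <= n.+1)%N.
Proof. by apply/leq_sizeP => j nj; rewrite coef_appell leqNgt nj. Qed.

Lemma natf_fact_neq0 n : (n`!%:R : K) != 0.
Proof. by rewrite pnatr_eq0 -lt0n fact_gt0. Qed.

Lemma deriv_appell a n : (appell a n.+1)^`() = n.+1%:R *: appell a n.
Proof.
apply/polyP => j; rewrite coef_deriv -[LHS]mulr_natl coefZ !coef_appell ltnS.
case: ifP => jn; last by rewrite !mulr0.
rewrite subSS !factS !natrM.
have j1 : (j.+1%:R : K) != 0 by rewrite pnatr_eq0.
have := natf_fact_neq0 j; move: (j.+1%:R : K) j1 (j`!%:R : K) => J J0 f f0.
by field; rewrite J0 f0.
Qed.

Lemma appellD a b n : appell (fun k => a k + b k) n = appell a n + appell b n.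
Proof.
by apply/polyP => j; rewrite coefD !coef_appell; case: ifP => _; rewrite ?mulrDr ?addr0.
Qed.

Lemma appellZ c a n : appell (fun k => c * a k) n = c *: appell a n.
Proof.
by apply/polyP => j; rewrite coefZ !coef_appell; case: ifP => _; rewrite ?mulr0 // mulrCA.
Qed.

Lemma appell_shift a n :
  appell (fun k => if k is k'.+1 then a k' else 0) n = (appell a n)^`().
Proof.
case: n => [|n].
  apply/polyP => j; rewrite coef_deriv !coef_appell ltn0 mul0rn.
  by case: ifP => // /[!leqn0] /eqP->; rewrite mulr0.
rewrite deriv_appell; apply/polyP => j; rewrite coefZ !coef_appell.
case: (ltngtP j n.+1) => [jn|jn|->].
- rewrite -ltnS jn subSn // mulrA; congr (_ * _).
  by rewrite factS natrM mulrA.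
- by rewrite leqNgt (ltn_trans _ jn) // mulr0.
- by rewrite subnn ltnn !mulr0.
Qed.

Lemma appell_poly_XsubC x (p : {poly K}) n :
  appell (fun k => (('X - x%:P) * p)`_k) n =
  (appell (fun k => p`_k) n)^`() - x *: appell (fun k => p`_k) n.
Proof.
rewrite -appell_shift -[in RHS]scaleNr -appellZ -appellD; congr (appell _ n); apply/funext => k.
by rewrite mulrBl coefB coefXM coefCM mulNr; case: k.
Qed.

Lemma appell_poly_1subZX x (p : {poly K}) n :
  appell (fun k => ((1 - x *: 'X) * p)`_k) n =
  appell (fun k => p`_k) n - x *: (appell (fun k => p`_k) n)^`().
Proof.
rewrite -appell_shift -[in RHS]scaleNr -appellZ -appellD; congr (appell _ n); apply/funext => k.
by rewrite mulrBl mul1r coefB -scalerAl coefZ coefXM mulNr; case: k.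
Qed.
End AppellAlgebra.

Lemma appell_map (K L : numFieldType) (f : {rmorphism K -> L}) (a : nat -> K) n :
  appell (fun k => f (a k)) n = map_poly f (appell a n).
Proof.
apply/polyP => j; rewrite coef_map !coef_appell /=.
case: ifP => _; last by rewrite rmorph0.
by rewrite rmorphM fmorph_div !rmorph_nat.
Qed.

Section AppellZeros.
Variable R : realType.
Implicit Types (a B : nat -> R) (p q : {poly R}).

Lemma off_leZ d (c : R) p : c != 0 -> off_le d p -> off_le d (c *: p).
Proof. by move=> c0 [s [s0 sp szp]]; exists s; rewrite dvdpZr // size_scale. Qed.

Lemma off_leZK d (c : R) p : c != 0 -> off_le d (c *: p) -> off_le d p.
Proof. by move=> c0 /(off_leZ (invr_neq0 c0)); rewrite scalerK. Qed.

Lemma off_le_deriv d p : off_le d p -> off_le d p^`().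
Proof. by move=> op; have := off_le_tdiff op (lexx 0); rewrite scale0r subr0. Qed.

(** The series stops at degree [d], so its Appell polynomial is divisible by [X ^ (n - d)]: all but
    [d] zeros sit at 0, which belongs to the half-line. *)
Lemma off_le_appell_small d q n : (size q <= d.+1)%N -> off_le d (appell (fun k => q`_k) n).
Proof.
move=> sq; exists (nseq (n - d) 0); split.
- by move=> x; rewrite mem_nseq => /andP[_ /eqP->].
- rewrite big_nseq subr0 iter_mulr_1.
  suff -> : appell (fun k => q`_k) n =
      \poly_(j < d.+1) (appell (fun k => q`_k) n)`_(j + (n - d)) * 'X^(n - d).
    by rewrite dvdp_mull.
  apply/polyP => j; rewrite coefMXn; case: ltnP => [jd|dj].
    rewrite coef_appell; case: ifP => // jn.
    by rewrite [q`__]nth_default ?mulr0 // (leq_trans sq) //; lia.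
  rewrite coef_poly subnK //; case: ltnP => // ?.
  by rewrite coef_appell; case: ifP => // jn; lia.
- by rewrite size_nseq (leq_trans (size_appell _ _)) //; lia.
Qed.

Lemma off_le_appell_poly d q (v : seq R) n : off_le d q -> {in v, forall x, 0 <= x} ->
  off_le d (appell (fun k => (q * lin_prod v)`_k) n).
Proof.
move=> [s [s0 /dvdpP[q1 ->] szq]] v0.
have [q10|q10] := eqVneq q1 0.
  rewrite q10 !mul0r; apply: off_le_appell_small; by rewrite size_poly0.
have sq1 : (size q1 <= d.+1)%N.
  move: szq; rewrite size_Mmonic ?monic_prod_XsubC // size_prod_XsubC addnS /=.
  by rewrite -addSn leq_add2r.
elim: v v0 => [|x v IH] v0; last first.
  have x0 : 0 <= x by rewrite v0 ?mem_head.
  have {}IH := IH (fun y yv => v0 y ltac:(by rewrite inE yv orbT)).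
  rewrite /lin_prod big_cons mulrCA -/(lin_prod v) appell_poly_1subZX.
  have [->|xn0] := eqVneq x 0; first by rewrite scale0r subr0.
  (* Since [1 - x D = - x (D - x^-1)], this kind of factor reduces to the other one. *)
  have -> : forall p, p - x *: p^`() = (- x) *: (p^`() - x^-1 *: p).
    by move=> p; rewrite scalerBr scalerA mulNr mulfV // !scaleNr scale1r opprK addrC.
  by apply: off_leZ; rewrite ?oppr_eq0 //; apply: off_le_tdiff => //; rewrite invr_ge0.
rewrite /lin_prod big_nil mulr1.
elim: s s0 {szq v0} => [|x s IH] s0; first by rewrite big_nil mulr1; exact: off_le_appell_small.
rewrite big_cons mulrCA appell_poly_XsubC; apply: off_le_tdiff; last by rewrite s0 ?mem_head.
by apply: IH => y ys; rewrite s0 // inE ys orbT.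
Qed.

Lemma lp_seq_at0 B : lp_seq B -> B 0%N = 1.
Proof.
move=> [w [s [_ _ cB _ _]]]; apply: (norm_cvg_unique (cB 0%N)); apply: cvg_near_cst; near=> n.
by have [-> _] := newton_lin_prod (w n).
Unshelve. all: by end_near.
Qed.

(** For fixed [n] only finitely many coefficients of [B] matter, and they are limits of those of the
    products [lin_prod (w j)]; the case of polynomials then passes to the limit. *)
Lemma off_le_appell_conv d q B n : off_le d q -> lp_seq B -> off_le d (appell (conv q B) n).
Proof.
move=> oq lB; have B0 := lp_seq_at0 lB; have [w [s [_ ws cB _ _]]] := lB.
have [->|q0] := eqVneq q 0.
  have -> : appell (conv 0 B) n = 0.
    by apply/polyP => j; rewrite conv0 coef_appell coef0; case: ifP => _; rewrite ?mulr0.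
  by exists [::]; rewrite big_nil dvd1p size_poly0.
have exm : exists m, q`_m != 0.
  by exists (size q).-1; rewrite -/(lead_coef q) lead_coef_eq0.
pose m := ex_minn exm.
have [qm qlt] : q`_m != 0 /\ forall k, (k < m)%N -> q`_k = 0.
  rewrite /m; case: ex_minnP => k qk kmin; split=> // j jk; apply/eqP.
  by apply: contraTT jk => /kmin; rewrite leqNgt.
have low b k : (k < m)%N -> conv q b k = 0.
  move=> km; rewrite /conv big1 // => i _; rewrite qlt ?mul0r //.
  by rewrite (leq_ltn_trans _ km) // -ltnS.
have [nm|mn] := ltnP n m.
  have -> : appell (conv q B) n = 0.
    apply/polyP => j; rewrite coef_appell coef0; case: ifP => // jn.
    by rewrite low ?mulr0 // (leq_ltn_trans _ nm) // leq_subr.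
  by exists [::]; rewrite big_nil dvd1p size_poly0.
have [U [UU ooU]] := ultraFilterLemma eventually_filter.
have PU := @ultra_proper _ U UU.
(* With [m] the order of [q] at 0, the Appell polynomials have no coefficient above [n - m], and the
   limit has there a nonzero multiple of [q_m], because [B 0 = 1]. *)
apply: (@off_le_closed R U (n - m) d (fun j => appell (fun k => (q * lin_prod (w j))`_k) n)) => //.
- rewrite coef_appell leq_subr subKn // mulf_neq0 ?mulf_neq0 ?invr_eq0 ?natf_fact_neq0 //.
  rewrite /conv big_ord_recr /= subnn B0 mulr1 big1 ?add0r // => i _.
  by rewrite qlt ?mul0r.
- near=> j; apply/leq_sizeP => k nk; rewrite coef_appell; case: ifP => // kn.
  have -> : (q * lin_prod (w j))`_(n - k) = conv q (fun k => (lin_prod (w j))`_k) (n - k).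
    by rewrite -coef_conv.
  rewrite low ?mulr0 //; move: (m) mn nk kn; clear; lia.
- by near=> j; apply: off_le_appell_poly => //; have [] := ws j.
- move=> k; rewrite coef_appell; under eq_fun do rewrite coef_appell.
  case: ifP => _; last exact: cvg_cst.
  apply: cvgM; first exact: cvg_cst.
  rewrite /conv; under eq_fun do rewrite coefM.
  apply: cvg_sumr => i _; apply: cvgM; first exact: cvg_cst.
  exact: cvg_trans (cvg_app _ ooU) (cB _).
Unshelve. all: by end_near.
Qed.
End AppellZeros.

(** * From bounded zero counts to a factorisation *)

Section AppellLimit.
Variable R : realType.
Implicit Types (a b B : nat -> R) (p q : {poly R}).

(** This is [X^N p(1/X)]; it turns [X - x] into [1 - x X], a form that has a limit when roots are
    divided by growing integers and that makes sense for [x = 0]. *)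
Definition reverse N p := \poly_(k < N.+1) p`_(N - k).

Lemma reverse_XsubC N p x : (size p <= N.+1)%N ->
  reverse N.+1 (('X - x%:P) * p) = (1 - x *: 'X) * reverse N p.
Proof.
move=> sp; apply/polyP => k.
rewrite [in RHS]mulrBl mul1r coefB -scalerAl coefZ coefXM !coef_poly.
rewrite mulrBl coefB coefXM coefCM.
have [kN|Nk] := ltnP k N.+2; last first.
  have -> : (k < N.+1)%N = false by lia.
  case: k Nk => // k Nk; have -> /= : (k.+1.-1 < N.+1)%N = false by lia.
  by rewrite mulr0 subr0.
case: k kN => [|k] kN.
  by rewrite subn0 /= mulr0 subr0 [p`_N.+1]nth_default // mulr0 subr0 subn0.
have -> /= : (k.+1.-1 < N.+1)%N by lia.
rewrite subSS; congr (_ - _); case: ltnP => kN'; last by rewrite (_ : (N - k)%N = 0%N) //; lia.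
by have -> : (N - k = (N - k.+1).+1)%N by lia.
Qed.

Lemma reverse_prod (s : seq R) N q : (size q <= N.+1)%N ->
  reverse (size s + N) (\prod_(x <- s) ('X - x%:P) * q) = lin_prod s * reverse N q.
Proof.
move=> sq; elim: s => [|x s IH]; first by rewrite /lin_prod !big_nil !mul1r.
rewrite /lin_prod !big_cons -!mulrA -/(lin_prod s) -IH [size (x :: s)]/= addSn reverse_XsubC //.
apply: leq_trans (size_polyMleq _ _) _; rewrite size_prod_XsubC addSn.
by rewrite /= -[leqRHS]addnS leq_add2l.
Qed.

Lemma conv_scale (c : R) p B : conv (c *: p) B = (fun k => c * conv p B k).
Proof.
apply/funext => k; rewrite /conv mulr_sumr; apply: eq_bigr => i _.
by rewrite coefZ mulrA.
Qed.

Lemma conv_XnM m p B :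
  conv ('X^m * p) B = (fun k => if (m <= k)%N then conv p B (k - m)%N else 0).
Proof.
elim: m => [|m IH].
  by rewrite expr0 mul1r; apply/funext => k; rewrite subn0.
have -> : 'X^(m.+1) * p = ('X^m * p) * 'X + 0%:P by rewrite addr0 exprS -mulrA mulrC.
rewrite conv_cons IH; apply/funext => -[|k]; rewrite mul0r addr0 //.
Qed.

Lemma cvg_ffact_ratio n0 k :
  ((n + n0).+1 ^_ k)%:R / (n + n0).+1%:R ^+ k @[n --> \oo] --> (1 : R).
Proof.
elim: k => [|k IH].
  by under eq_fun do rewrite ffactn0 expr0 divr1; exact: cvg_cst.
have c0 : k%:R / (n + n0).+1%:R @[n --> \oo] --> (0 : R).
  by rewrite (cvg_shiftn n0 (fun n => k%:R / n.+1%:R : R)); exact: cvg_div_n.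
have : ((n + n0).+1 ^_ k)%:R / (n + n0).+1%:R ^+ k * (1 - k%:R / (n + n0).+1%:R) @[n --> \oo] -->
   (1 * (1 - 0) : R).
  by apply: cvgM => //; apply: cvgB => //; exact: cvg_cst.
rewrite subr0 mulr1; apply: cvg_trans; apply: near_eq_cvg; near=> n.
have kn : (k <= (n + n0).+1)%N.
  by apply: (@leq_trans n); [near: n; exact: nbhs_infty_ge|rewrite -addnS leq_addr].
rewrite ffactnSr natrM natrB // exprSr.
have N0 : ((n + n0).+1%:R : R) != 0 by rewrite pnatr_eq0.
have Nk0 : ((n + n0).+1%:R : R) ^+ k != 0 by rewrite expf_neq0.
by move: (_.+1%:R : R) N0 Nk0 => N N0 Nk0; field; rewrite N0 Nk0.
Unshelve. all: by end_near.
Qed.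

(* Reversing [appell b n] and dividing the variable by [n] gives a polynomial
   whose coefficients tend to those of the series. *)
Lemma appell_factor M b n : b 0%N != 0 -> off_le M (appell b n.+1) ->
  exists (P : {poly R}) (v : seq R), [/\ (size P <= M.+1)%N, P`_0 = 1,
    {in v, forall x, 0 <= x} &
    forall k, (k <= n.+1)%N ->
     (P * lin_prod v)`_k = (n.+1 ^_ k)%:R / n.+1%:R ^+ k * (b k / b 0%N)].
Proof.
move=> b0 [s [s0 /dvdpP[q]]]; rewrite mulrC => aE sza.
(* [b 0] is the leading coefficient, so its nonvanishing fixes the degree and, after reversal, lets
   the constant coefficient be normalised to 1. *)
have lead : (appell b n.+1)`_n.+1 = b 0%N.
  by rewrite coef_appell leqnn subnn divff ?mul1r // natf_fact_neq0.
have szA : size (appell b n.+1) = n.+2.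
  apply/eqP; rewrite eqn_leq size_appell /= ltnNge; apply/negP => /leq_sizeP /(_ n.+1 (leqnn _)).
  by rewrite lead => /eqP; rewrite (negPf b0).
have q0 : q != 0.
  by apply: contra_eq_neq szA => q0; rewrite aE q0 mulr0 size_poly0.
have szq : (size s + size q)%N = n.+2.
  by rewrite -szA aE size_monicM ?monic_prod_XsubC // size_prod_XsubC.
have szq' : size q = (size q).-1.+1 by rewrite prednK // size_poly_gt0.
pose N := (size q).-1.
have sN : (size s + N)%N = n.+1 by rewrite /N; move: szq szq'; lia.
pose t : R := n.+1%:R^-1.
exists (scale_poly M t ((b 0%N)^-1 *: reverse N q)), [seq t * x | x <- s].
have rsz : (size ((b 0%N)^-1 *: reverse N q) <= M.+1)%N.
  rewrite (leq_trans (size_scale_leq _ _)) // (leq_trans (size_poly _ _)) // /N.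
  by move: sza; rewrite szA; lia.
have revE : lin_prod s * reverse N q = reverse n.+1 (appell b n.+1).
  by rewrite aE -sN reverse_prod // -szq'.
split.
- exact: size_poly.
- rewrite coef_scale_poly // expr0 mulr1 coefZ.
  suff -> : (reverse N q)`_0 = b 0%N by rewrite mulVf.
  have := congr1 (fun p : {poly R} => p`_0) revE.
  rewrite coefM big_ord1 /= (newton_lin_prod s).1 mul1r => ->.
  by rewrite coef_poly /= subn0 lead.
- by move=> _ /mapP[x xs ->]; apply: mulr_ge0 (s0 x xs); rewrite invr_ge0.
- move=> k kn; rewrite coef_scaleM // -scalerAl coefZ mulrC [reverse _ _ * _]mulrC revE.
  rewrite coef_poly ltnS kn coef_appell leq_subr subKn //.
  rewrite -(ffact_fact kn) natrM mulfK ?natf_fact_neq0 // /t exprVn.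
  by ring.
Qed.

Lemma appell_limit0 M n0 b : b 0%N != 0 -> (forall n, (n0 <= n)%N -> off_le M (appell b n)) ->
  exists (P : {poly R}) B, [/\ (size P <= M.+1)%N, lp_seq B & b = conv P B].
Proof.
move=> b0 off.
have /choice[P_ /choice[v_ PvP]] := fun n => appell_factor b0 (off (n + n0).+1 (leqW (leq_addl n n0))).
have [|||k|P [B [szP lB bE]]] := @factor_limit R M P_ v_ (fun k => b k / b 0%N).
- by move=> n; have [] := PvP n.
- by move=> n; have [] := PvP n.
- by move=> n; have [] := PvP n.
- have : ((n + n0).+1 ^_ k)%:R / (n + n0).+1%:R ^+ k * (b k / b 0%N) @[n --> \oo] -->
     (1 * (b k / b 0%N) : R).
    by apply: cvgM; [exact: cvg_ffact_ratio|exact: cvg_cst].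
  rewrite mul1r; apply: cvg_trans; apply: near_eq_cvg; near=> n.
  have kn : (k <= (n + n0).+1)%N.
    by apply: (@leq_trans n); [near: n; exact: nbhs_infty_ge|rewrite -addnS leq_addr].
  by have [_ _ _ /(_ k kn)] := PvP n.
exists (b 0%N *: P), B; split=> //; first by rewrite size_scale.
by rewrite conv_scale -bE; apply/funext => k; rewrite mulrC divfK.
Unshelve. all: by end_near.
Qed.

(** Multiplying the series by [X] differentiates its Appell polynomials, and differentiation lowers
    the index. This removes a zero of order [m] at the origin, so that the constant term can be
    assumed nonzero. *)
Lemma appell_shiftn m b n : 
  appell (fun k => if (m <= k)%N then b (k - m)%N else 0) (m + n) =
  ((m + n) ^_ m)%:R *: appell b n.
Proof.
apply/polyP => j; rewrite coefZ !coef_appell; case: (leqP j n) => jn.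
  have -> : (j <= m + n)%N by lia.
  have -> : (m <= m + n - j)%N by lia.
  have -> : (m + n - j - m = n - j)%N by lia.
  by rewrite -(ffact_fact (leq_addr n m)) addKn natrM; ring.
rewrite mulr0; case: ifP => // jmn.
rewrite ifF ?mulr0 //; lia.
Qed.

Lemma appell_limit M n0 a : (forall n, (n0 <= n)%N -> off_le M (appell a n)) ->
  exists m (P : {poly R}) B, [/\ (size P <= M.+1)%N, lp_seq B & a = conv ('X^m * P) B].
Proof.
move=> off; have [a0|/existsNP[k0 /eqP ak0]] := pselect (forall k, a k = 0).
  have [B lB _] : exists2 B, lp_seq B & forall z, psum (fun k => toC (B k)) z =
      cexp (- toC 0 * z) * (fun=> 1 : Cplx R) z.
    by apply: lp_seq_product => //; left; exists [::] => // z; rewrite big_nil.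
  exists 0%N, 0, B; split=> //; first by rewrite size_poly0.
  by rewrite mulr0 conv0; apply/funext.
have exm : exists m, a m != 0 by exists k0.
case: (ex_minnP exm) => m am mmin.
pose b k := a (m + k)%N.
have aE : a = (fun k => if (m <= k)%N then b (k - m)%N else 0).
  apply/funext => k; rewrite /b; case: leqP => [mk|km]; first by rewrite subnKC.
  by apply/eqP; apply: contraTT km => /mmin; rewrite leqNgt.
have [|n n0n|P [B [szP lB bE]]] := @appell_limit0 M n0 b.
- by rewrite /b addn0.
- have := off (m + n)%N (leq_trans n0n (leq_addl m n)).
  rewrite aE appell_shiftn; apply: off_leZK.
  by rewrite pnatr_eq0 -lt0n ffact_gt0 leq_addr.
by exists m, P, B; split=> //; rewrite conv_XnM -bE.
Qed.
End AppellLimit.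

(** * Membership in the classes and the final count *)

Section Classes.
Variable R : realType.
Local Notation C := (Cplx R).
Implicit Types (a B : nat -> R) (q : {poly R}).

Lemma fast_decay_conv q B : lp_seq B -> fast_decay (fun k => toC (conv q B k)).
Proof.
move=> /fast_decay_lp_seq fB; rewrite -conv_toC.
by have [] := psum_conv (map_poly (@toC R) q) fB.
Qed.

Lemma psum_conv_toC q B z : lp_seq B ->
  psum (fun k => toC (conv q B k)) z =
  (map_poly (@toC R) q).[z] * psum (fun k => toC (B k)) z.
Proof.
move=> /fast_decay_lp_seq fB; rewrite -conv_toC.
by have [_ ->] := psum_conv (map_poly (@toC R) q) fB.
Qed.

(** The factor coming from [B] has no zero off the half-line, so only the roots of the polynomial
    factor are counted. *)
Lemma nb_zeros_conv q B : lp_seq B ->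
  nb_zeros (psum (fun k => toC (conv q B k))) (@offS0 R) =
  nb_zeros (horner (map_poly (@toC R) q)) (@offS0 R).
Proof.
move=> lB; have fB := fast_decay_lp_seq lB.
have -> : psum (fun k => toC (conv q B k)) =
  (fun z => (map_poly (@toC R) q).[z] * psum (fun k => toC (B k)) z).
  by apply/funext => z; rewrite psum_conv_toC.
have [->|q0] := eqVneq q 0.
  rewrite rmorph0; congr nb_zeros; apply/funext => z; by rewrite horner0 mul0r.
have pc0 : map_poly (@toC R) q != 0 by rewrite map_poly_eq0.
have [ws qE] := poly_split (map_poly (@toC R) q).
have l0 : lead_coef (map_poly (@toC R) q) != 0 by rewrite lead_coef_eq0.
rewrite qE; move: (lead_coef _) l0 => c c0.
rewrite nb_zeros_prod //; have fcB := fast_decayZ c fB.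
rewrite -(nb_zeros_mulXs _ fcB) => [|z].
  congr nb_zeros; apply/funext => z; rewrite psum_mulXs // psumZ // hornerZ horner_prod.
  rewrite mulrA [c * _]mulrC; congr (_ * _ * _).
  by apply: eq_bigr => w _; rewrite hornerXsubC.
move=> Xz; rewrite psumZ // mulf_neq0 //; apply: lp_seq_neq0 => //.
by apply/negP.
Qed.

Lemma real_toC (z : C) : z \is Num.real -> exists x, z = toC x.
Proof.
rewrite realE => /orP[z0|z0]; first by exists (nrm z); rewrite -normC ger0_norm.
by exists (- nrm z); have := normC z; rewrite (ler0_norm z0) => zE; rewrite [RHS]rmorphN /= -zE opprK.
Qed.

Transparent Cplx.
Lemma toC_ReIm (z : C) : z = toC (complex.Re z) + ('i%C : C) * toC (complex.Im z).
Proof. exact: complexE. Qed.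

Lemma Im_toCD (x y : R) : complex.Im (toC x + ('i%C : C) * toC y) = y.
Proof. by rewrite /toC /= !mul0r mul1r !add0r. Qed.

Lemma Im_toC (x : R) : complex.Im (toC x) = 0.
Proof. by []. Qed.
Opaque Cplx.

(** The imaginary parts of the coefficients form a real polynomial that vanishes at every real
    point, hence has more roots than its degree allows. *)
Lemma real_horner_poly (P : {poly C}) : real_function (horner P) ->
  exists q, P = map_poly (@toC R) q.
Proof.
move=> rP; pose q := \poly_(i < size P) complex.Re P`_i.
pose r := \poly_(i < size P) complex.Im P`_i.
have PE : P = map_poly (@toC R) q + ('i%C : C) *: map_poly (@toC R) r.
  apply/polyP => i; rewrite coefD coefZ (coef_map (@toC R) q) (coef_map (@toC R) r).
  rewrite /= [q`_i]coef_poly [r`_i]coef_poly.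
  case: ltnP => iP; first exact: toC_ReIm.
  by rewrite nth_default // rmorph0 mulr0 addr0.
have rx x : r.[x] = 0.
  have [y yE] := real_toC (rP x).
  have := congr1 (fun z : C => complex.Im z) yE.
  by rewrite {1}PE hornerD hornerZ !horner_map Im_toCD Im_toC.
have r0 : r = 0.
  apply/eqP; apply: contraT => r0.
  have := @max_poly_roots _ r [seq i%:R | i <- iota 0 (size r)] r0.
  rewrite size_map size_iota ltnn; apply.
    by apply/allP => _ /mapP[i _ ->]; apply/rootP.
  by rewrite map_inj_uniq ?iota_uniq //; exact: mulrIn (oner_neq0 R).
by exists q; rewrite {1}PE r0 rmorph0 scaler0 addr0.
Qed.

(** The factor [c z^m] joins the polynomial, leaving a function with value 1 at 0, as [lp_seq] asks;
    equality of the entire functions then gives equality of their Taylor coefficients. *)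
Lemma LP_S0_star_conv a : infinite_radius (fun k => toC (a k)) ->
  LP_S0_star (psum (fun k => toC (a k))) -> exists q B, lp_seq B /\ a = conv q B.
Proof.
move=> /radius_fast_decay fa [_ _ [P [g [rP [_ _ [c [m [alpha [p [a0 lp gE]]]]]] fE]]]].
have [q PE] := real_horner_poly rP.
have [B lB BE] := lp_seq_product a0 lp.
exists ((c *: 'X^m) * q), B; split=> //; apply/funext => k; apply: (@toC_inj R).
suff : (fun k => toC (a k)) = (fun k => toC (conv (c *: 'X^m * q) B k)).
  by move=> /(congr1 (fun h : nat -> C => h k)).
apply: psum_inj => //; first exact: fast_decay_conv.
apply/funext => z; rewrite fE gE psum_conv_toC // BE PE rmorphM /= map_polyZ map_polyXn.
by rewrite hornerM hornerZ hornerXn /=; ring.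
Qed.

Lemma LP_S0_star_of_conv q B : lp_seq B -> LP_S0_star (psum (fun k => toC (conv q B k))).
Proof.
move=> lB; have fq := fast_decay_conv q lB; split.
- by move=> z; exact: derivable_psum.
- exact: psum_real.
exists (map_poly (@toC R) q), (psum (fun k => toC (B k))); split.
- move=> x; rewrite horner_map realE -(rmorph0 (@toC R)) !ler_toC; exact: le_total.
- exact: lp_seq_LP_S0.
- by move=> z; rewrite psum_conv_toC.
Qed.
End Classes.

Lemma nondecreasing_bounded_eventually (e : nat -> nat) M :
  (forall n, e n <= e n.+1)%N -> (forall n, e n <= M)%N ->
  exists n0, forall n, (n0 <= n)%N -> e n = e n0.
Proof.
move=> e1 eM; have mono := homo_leq leqnn leq_trans e1.
have ex : exists d, `[< exists n, e n = d >] by exists (e 0%N); apply/asboolP; exists 0%N.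
have bd d : `[< exists n, e n = d >] -> (d <= M)%N by move=> /asboolP[n <-].
case: (ex_maxnP ex bd) => _ /asboolP[n0 <-] emax.
exists n0 => n n0n; apply: anti_leq; apply/andP; split; last exact: mono.
by apply: emax; apply/asboolP; exists n.
Qed.

Theorem theorem3p5 (R : realType) (a : nat -> R) :
  let ac : nat -> Cplx R := fun k => toC (a k) in
  let f : Cplx R -> Cplx R := psum ac in
  let Nn : nat -> \bar R :=
    fun n => nb_zeros (horner (appell ac n)) (@offS0 R) in
  [/\ Nn 0%N = 0%E /\ (forall n, (Nn n <= Nn n.+1)%E),
      infinite_radius ac -> LP_S0_star f ->
        let N := nb_zeros f (@offS0 R) in
        (forall n, (Nn n <= N)%E) /\
        (exists n0, forall n, (n0 <= n)%N -> Nn n = N)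
    & (exists M : nat, forall n, (Nn n <= M%:R%:E)%E) ->
        infinite_radius ac /\ LP_S0_star f].
Proof.
move=> ac f Nn.
have NnE n : Nn n = nb_zeros (horner (map_poly (@toC R) (appell a n))) (@offS0 R).
  by rewrite /Nn /ac appell_map.
have /choice[e eE] : forall n, exists d : nat, Nn n = d%:R%:E.
  by move=> n; exact: nb_zeros_poly_nat.
have offP d n : (Nn n <= d%:R%:E)%E <-> off_le d (appell a n).
  by rewrite NnE; exact: off_le_nb_zeros.
have mono n : (Nn n <= Nn n.+1)%E.
  rewrite (eE n.+1); apply/offP; apply: (@off_leZK _ _ n.+1%:R); first by rewrite pnatr_eq0.
  by rewrite -deriv_appell; apply: off_le_deriv; apply/offP; rewrite eE.
have emono n : (e n <= e n.+1)%N by have := mono n; rewrite !eE lee_fin ler_nat.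
split.
- split=> //; have := (offP 0%N 0%N).2; rewrite eE lee_fin ler_nat leqn0 => /(_ _)/eqP-> //.
  by exists [::]; rewrite big_nil dvd1p; split=> //; exact: size_appell.
- move=> ra fS N; have [q [B [lB aE]]] := LP_S0_star_conv ra fS.
  have NE : N = nb_zeros (horner (map_poly (@toC R) q)) (@offS0 R).
    by rewrite /N /f /ac aE nb_zeros_conv.
  have [d dE] : exists d : nat, N = d%:R%:E by rewrite NE; exact: nb_zeros_poly_nat.
  have upper n : (Nn n <= N)%E.
    rewrite dE; apply/offP; rewrite aE; apply: off_le_appell_conv => //.
    by apply/off_le_nb_zeros; rewrite -NE dE.
  split=> //.
  have [n0 n0P] : exists n0, forall n, (n0 <= n)%N -> e n = e n0.
    apply: (@nondecreasing_bounded_eventually e d) => // n.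
    by have := upper n; rewrite eE dE lee_fin ler_nat.
  exists n0 => n n0n; apply/eqP; rewrite eq_le upper /=.
  (* The stable value [e n0] itself serves as the bound in the limit argument. It yields another
     factorisation of the same series, with [P] of degree at most [e n0]; [X^m] adds zeros at 0
     only. *)
  have [m [P [B' [szP lB' aE']]]] : exists m (P : {poly R}) B',
      [/\ (size P <= (e n0).+1)%N, lp_seq B' & a = conv ('X^m * P) B'].
    by apply: (@appell_limit _ _ n0) => k n0k; apply/offP; rewrite eE n0P.
  rewrite eE n0P // /N /f /ac aE' nb_zeros_conv //; apply/off_le_nb_zeros.
  exists (nseq m 0); split.
  + by move=> x; rewrite mem_nseq => /andP[_ /eqP->].
  + by rewrite big_nseq subr0 iter_mulr_1 dvdp_mulr.
  + rewrite size_nseq (leq_trans (size_polyMleq _ _)) // size_polyXn addSn /=.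
    by rewrite addnC -addSn leq_add2r.
- move=> [M bM].
  have [m [P [B [_ lB aE]]]] : exists m (P : {poly R}) B,
      [/\ (size P <= M.+1)%N, lp_seq B & a = conv ('X^m * P) B].
    by apply: (@appell_limit _ _ 0%N) => n _; apply/offP.
  rewrite /f /ac aE; split; last exact: LP_S0_star_of_conv.
  by apply: fast_decay_radius; exact: fast_decay_conv.
Qed.
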